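(* Let $K[\mathcal S]$ be a simplicial semigroup ring and let $$\mathcal S':=\{b_1,\dots,b_D\}+\mathbb N\{\omega_{n-d+1}e_1,\dots,\omega_ne_d\},$$ with $b_1,\dots,b_D$ the vectors defined in the context. Then $K[\mathcal S']$ is the Macaulayfication of $K[\mathcal S]$.
   Context: $K$ is an infinite field. $\mathcal A=\{a_1,\dots,a_n\}\subset\mathbb N^d$ ($d\ge1$) is a set of nonzero vectors with $a_{n-d+i}=\omega_{n-d+i}e_i$ for $i\in\{1,\dots,d\}$, where $\omega_{n-d+i}\in\mathbb Z^+$ and $\{e_1,\dots,e_d\}$ is the canonical basis of $\mathbb N^d$. $\mathcal S\subset\mathbb N^d$ is the semigroup (with $0$) generated by $\mathcal A$ and $K[\mathcal S]=K[t^s\mid s\in\mathcal S]$ is the associated simplicial semigroup ring, of Krull dimension $d$. Let $\mathcal S_0=\{s\in\mathcal S\mid s-a_i\notin\mathcal S\text{ for all }i\in\{n-d+1,\dots,n\}\}$. On $\mathbb Z^d$ put $s_1\sim s_2\iff s_1-s_2\in\mathbb Z\{\omega_{n-d+1}e_1,\dots,\omega_ne_d\}$. The set $\mathcal S_0$ is partitioned by $\sim$ into $D:=\omega_{n-d+1}\cdots\omega_n/[\mathbb Z^d:\mathbb Z\mathcal S]$ equivalence classes $S^1,\dots,S^D$, where $\mathbb Z\mathcal S$ is the subgroup of $\mathbb Z^d$ generated by $\mathcal S$. For each $i$, $b_i=(b_{i1},\dots,b_{id})\in\mathbb N^d$ is the vector whose $k$-th coordinate $b_{ik}$ is the minimum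 of the $k$-th coordinates of the elements of $S^i$. For a semigroup $\mathcal S'\subset\mathbb N^d$, $K[\mathcal S']$ is the Macaulayfication of $K[\mathcal S]$ if: (1) $\mathcal S\subset\mathcal S'$; (2) $K[\mathcal S']$ is Cohen–Macaulay; (3) the Krull dimension of $K[\mathcal S'\setminus\mathcal S]$ is at most $d-2$. Here $K[\mathcal S'\setminus\mathcal S]$ denotes the cokernel $K[\mathcal S']/K[\mathcal S]$ of the inclusion $K[\mathcal S]\to K[\mathcal S']$, viewed as a $K[\mathcal S]$-module (the zero module having dimension $-\infty$). In particular the assertion includes that $\mathcal S'$ is a semigroup. *)

(* Defs.v *)
From HB Require Import structures.
From mathcomp Require Import all_boot all_order all_algebra.
From mathcomp Require Import boolp classical_sets functions cardinality.
From mathcomp Require Import mpoly.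

Set Implicit Arguments.
Unset Strict Implicit.
Unset Printing Implicit Defensive.

Import GRing.Theory.

Local Open Scope classical_set_scope.
Local Open Scope ring_scope.

(* Ideals are arbitrary (non-decidable) subsets of the ring. *)

Section CommutativeAlgebra.
Variable R : comNzRingType.
Implicit Types (I J : set R) (s : seq R) (n l : nat).

Definition is_ideal I :=
  [/\ I 0, forall x y, I x -> I y -> I (x + y) & forall r x, I x -> I (r * x)].

Definition is_prime_ideal I :=
  [/\ is_ideal I, ~ I 1 & forall x y, I (x * y) -> I x \/ I y].

Definition is_maximal_ideal I :=
  [/\ is_ideal I, ~ I 1 &
      forall J, is_ideal J -> ~ J 1 -> I `<=` J -> J = I].

Definition ideal_gen s : set R :=
  [set x | exists c : 'I_(size s) -> R, x = \sum_(i < size s) c i * s`_i].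

Definition noetherian := forall I, is_ideal I -> exists s, I = ideal_gen s.

(* s_0, s_1, ... is regular: s_i is a nonzerodivisor on R / (s_0, ..., s_(i-1))
   for every i, and R / (s) is nonzero. *)
Definition regular_seq s :=
  (forall i, (i < size s)%N -> forall y,
     ideal_gen (take i s) (s`_i * y) -> ideal_gen (take i s) y)
  /\ ~ ideal_gen s 1.

Definition depth_is I n :=
  (exists s, [/\ regular_seq s, {in s, forall x, I x} & size s = n]) /\
  (forall s, regular_seq s -> {in s, forall x, I x} -> (size s <= n)%N).

(* P 0 < P 1 < ... < P l, a strict chain of primes of length l; the values of
   P beyond l are irrelevant. *)
Definition prime_chain (P : nat -> set R) l :=
  (forall i, (i <= l)%N -> is_prime_ideal (P i)) /\
  (forall i, (i < l)%N -> P i `<` P i.+1).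

Definition height_is I n :=
  (exists P, prime_chain P n /\ P n = I) /\
  (forall P l, prime_chain P l -> P l = I -> (l <= n)%N).

(* Depth and codimension agree at every maximal ideal (Eisenbud, Commutative
   Algebra, section 18.2); no localization is needed in this form. *)
Definition cohen_macaulay :=
  noetherian /\
  forall M, is_maximal_ideal M -> exists n, depth_is M n /\ height_is M n.

Definition annihilator (M : lmodType R) : set R :=
  [set r | forall m : M, r *: m = 0].

(* The Krull dimension of M, i.e. that of R / Ann(M), is at most z.  The zero
   module has dimension -oo: no prime contains its annihilator, so that the
   bound holds for every z, and only the zero module satisfies it for z < 0. *)
Definition module_dim_le (M : lmodType R) (z : int) :=
  forall P l, prime_chain P l -> annihilator M `<=` P 0 -> (l%:Z <= z)%R.

End CommutativeAlgebra.

Section Cokernel.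
Variables (R R' : comNzRingType) (f : {rmorphism R -> R'}).

Definition im_pred : {pred R'} := fun y => `[< exists x, f x = y >].

Lemma im_pred_zmod_closed : zmod_closed im_pred.
Proof.
split=> [|x y /asboolP[u <-] /asboolP[v <-]]; apply/asboolP.
  by exists 0; rewrite rmorph0.
by exists (u - v); rewrite rmorphB.
Qed.
HB.instance Definition _ := GRing.isZmodClosed.Build R' im_pred
  im_pred_zmod_closed.

(* The quotient R' / f(R), as an R-module through f. *)
Definition coker := Quotient.quot im_pred.
HB.instance Definition _ := GRing.Zmodule.on coker.

Local Open Scope quotient_scope.

Definition coker_pi (y : R') : coker := \pi_(Quotient.quot im_pred) y.

Definition coker_scale (r : R) (m : coker) : coker := coker_pi (f r * repr m).

Lemma coker_piP x y : coker_pi x = coker_pi y <-> exists r, f r = x - y.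
Proof.
split=> [/eqP|[r frE]]; first by rewrite -Quotient.idealrBE => /asboolP.
by apply/eqP; rewrite -Quotient.idealrBE; apply/asboolP; exists r.
Qed.

Lemma coker_reprK m : coker_pi (repr m) = m.
Proof. exact: reprK. Qed.

Lemma coker_piD : {morph coker_pi : x y / x + y}.
Proof. by move=> x y; rewrite /coker_pi raddfD. Qed.

Lemma coker_scaleE r y : coker_scale r (coker_pi y) = coker_pi (f r * y).
Proof.
have /coker_piP[u fu] := coker_reprK (coker_pi y).
by apply/coker_piP; exists (r * u); rewrite rmorphM fu mulrBr.
Qed.

Fact coker_scaleA r s m :
  coker_scale r (coker_scale s m) = coker_scale (r * s) m.
Proof. by rewrite -(coker_reprK m) !coker_scaleE rmorphM mulrA. Qed.

Fact coker_scale1 : left_id 1 coker_scale.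
Proof. by move=> m; rewrite -(coker_reprK m) coker_scaleE rmorph1 mul1r. Qed.

Fact coker_scaleDr : right_distributive coker_scale +%R.
Proof.
move=> r m m'; rewrite -(coker_reprK m) -(coker_reprK m').
by rewrite -coker_piD !coker_scaleE -coker_piD mulrDr.
Qed.

Fact coker_scaleDl m : {morph coker_scale^~ m : r s / r + s}.
Proof.
move=> r s; rewrite -(coker_reprK m).
by rewrite !coker_scaleE -coker_piD rmorphD mulrDl.
Qed.

HB.instance Definition _ := GRing.Zmodule_isLmodule.Build R coker
  coker_scaleA coker_scale1 coker_scaleDr coker_scaleDl.

End Cokernel.

(* N^d is the type 'X_{1..d} of exponents of monomials in d variables. *)

Record semigroup (d : nat) := Semigroup {
  sg_set :> set 'X_{1..d};
  sg0 : sg_set 0%MM;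
  sgD : forall s1 s2, sg_set s1 -> sg_set s2 -> sg_set (s1 + s2)%MM
}.

Section SemigroupRing.
Variables (K : fieldType) (d : nat) (S : semigroup d).

Definition supp_in : {pred {mpoly K[d]}} :=
  fun p => all (fun s => `[< sg_set S s >]) (msupp p).

Lemma supp_inP (p : {mpoly K[d]}) :
  reflect (forall s, s \in msupp p -> sg_set S s) (p \in supp_in).
Proof.
apply: (iffP allP) => H s /H; first by move/asboolP.
by move=> Ss; apply/asboolP.
Qed.

Lemma supp_in_subring_closed : subring_closed supp_in.
Proof.
split.
- by apply/supp_inP => s; rewrite msupp1 inE => /eqP ->; apply: sg0.
- move=> p q /supp_inP Hp /supp_inP Hq; apply/supp_inP => s.
  by move=> /msuppB_le; rewrite mem_cat => /orP[/Hp|/Hq].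
- move=> p q /supp_inP Hp /supp_inP Hq; apply/supp_inP => s.
  move=> /msuppM_le /allpairsP[[u v]] /= [/Hp Su /Hq Sv ->].
  exact: sgD.
Qed.
HB.instance Definition _ := GRing.isSubringClosed.Build {mpoly K[d]} supp_in
  supp_in_subring_closed.

(* K[S], as the subring of K[t_1, ..., t_d] spanned by the t^s with s in S. *)
Record sgring := SGRing {
  sgring_val :> {mpoly K[d]};
  sgring_valP : sgring_val \in supp_in
}.
HB.instance Definition _ := [isSub for sgring_val].
HB.instance Definition _ := [Choice of sgring by <:].
HB.instance Definition _ := [SubChoice_isSubComNzRing of sgring by <:].

End SemigroupRing.

Section Inclusion.
Variables (K : fieldType) (d : nat) (S S' : semigroup d) (hS : S `<=` S').

Lemma supp_in_sub (p : sgring K S) : (p : {mpoly K[d]}) \in supp_in S'.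
Proof.
by apply/supp_inP => s sp; apply: hS; move/supp_inP: (sgring_valP p); apply.
Qed.

Definition sgring_incl (p : sgring K S) : sgring K S' :=
  SGRing (supp_in_sub p).

Fact sgring_incl_zmod : zmod_morphism sgring_incl.
Proof. by move=> p q; apply: val_inj. Qed.
Fact sgring_incl_monoid : monoid_morphism sgring_incl.
Proof. by split=> [|p q]; apply: val_inj. Qed.
HB.instance Definition _ := GRing.isZmodMorphism.Build (sgring K S)
  (sgring K S') sgring_incl sgring_incl_zmod.
HB.instance Definition _ := GRing.isMonoidMorphism.Build (sgring K S)
  (sgring K S') sgring_incl sgring_incl_monoid.

End Inclusion.
Arguments sgring_incl K {d S S'} hS.

Definition is_macaulayfication (K : fieldType) (d : nat) (S S' : semigroup d) :=
  exists hS : S `<=` S',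
    cohen_macaulay (sgring K S') /\
    @module_dim_le (sgring K S) (coker (sgring_incl K hS)) (d%:Z - 2).

Section Construction.
Variable d : nat.

Definition nspan n (a : 'I_n -> 'X_{1..d}) : set 'X_{1..d} :=
  [set s | exists c : 'I_n -> nat, s = (\sum_(j < n) a j *+ c j)%MM].

Lemma nspan0 n (a : 'I_n -> 'X_{1..d}) : nspan a 0%MM.
Proof.
by exists (fun=> 0%N); rewrite big1.
Qed.

Lemma nspanD n (a : 'I_n -> 'X_{1..d}) s1 s2 :
  nspan a s1 -> nspan a s2 -> nspan a (s1 + s2)%MM.
Proof.
move=> [c1 ->] [c2 ->]; exists (fun j => c1 j + c2 j)%N.
rewrite -big_split /=; apply: eq_bigr => j _.
by apply/mnmP => k; rewrite mnmDE !mulmnE mulnDr.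
Qed.

Definition gen_semigroup n (a : 'I_n -> 'X_{1..d}) : semigroup d :=
  Semigroup (nspan0 a) (@nspanD n a).

Definition zvec (s : 'X_{1..d}) : 'rV[int]_d := \row_k (s k)%:Z.

Definition zspan n (v : 'I_n -> 'rV[int]_d) : set 'rV[int]_d :=
  [set x | exists c : 'I_n -> int, x = \sum_(j < n) v j *~ c j].

Variables (S : semigroup d) (omega : 'I_d -> nat).

Definition axis (i : 'I_d) : 'X_{1..d} := (U_(i) *+ omega i)%MM.

Definition S0 : set 'X_{1..d} :=
  [set s | sg_set S s /\ forall i, ~ (zvec @` S) (zvec s - zvec (axis i))].

Definition sim (s1 s2 : 'X_{1..d}) : Prop :=
  zspan (zvec \o axis) (zvec s1 - zvec s2).

Definition S0_class (C : set 'X_{1..d}) : Prop :=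
  exists2 s0, S0 s0 & C = [set s | S0 s /\ sim s s0].

Definition is_min_vector (C : set 'X_{1..d}) (b : 'X_{1..d}) : Prop :=
  forall k, (exists2 s, C s & b k = s k) /\ (forall s, C s -> (b k <= s k)%N).

(* {b_1, ..., b_D}, indexed by the classes themselves. *)
Definition min_vectors : set 'X_{1..d} :=
  [set b | exists2 C, S0_class C & is_min_vector C b].

Definition sprime : set 'X_{1..d} :=
  [set s | exists b u,
     [/\ min_vectors b, nspan axis u & s = (b + u)%MM]].

End Construction.

(* Main.v *)
(**
Write T_k for the monomial of omega_k e_k and call x, y congruent if x_k and y_k
agree modulo omega_k for all k.  Then S' consists of the x in N^d such that, for
every k, some s in S congruent to x satisfies s_k <= x_k; in this form S' is
clearly a semigroup.  Membership of x in S' amounts to an independent condition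
on each coordinate within a congruence class, so that K[S'] is free over
K[T_1, ..., T_d], and division by a polynomial in T_k is an additive operator on
K[S'] that commutes with multiplication by the T_j, j != k.

Cohen-Macaulayness: by Zariski's lemma a maximal ideal M contains a nonzero
polynomial f_k(T_k) for every k, and the division operators show that
f_1(T_1), ..., f_d(T_d) is a regular sequence.  In any ring a regular sequence
of length l in a prime ideal gives a chain of primes of length l that ends there,
and chains in K[S'] have length at most d because any d+1 polynomials in d
variables are algebraically dependent; so depth and height of M are both d.

Cokernel: for each k and N large, the product of the T_j^N, j != k, annihilates
K[S']/K[S].  Hence a prime P containing the annihilator contains T_i and T_j for
some i != j, therefore all monomials involving t_i or t_j, and a dependence count
in the d-2 remaining variables bounds the chains of primes that start at P.
*)

Require Import Defs.
From HB Require Import structures.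
From mathcomp Require Import all_boot all_order all_algebra.
From mathcomp Require Import boolp classical_sets functions cardinality.
From mathcomp Require Import mpoly.
From mathcomp Require Import zify ring.

Set Implicit Arguments.
Unset Strict Implicit.
Unset Printing Implicit Defensive.

Import GRing.Theory.

Local Open Scope classical_set_scope.
Local Open Scope ring_scope.

(** * Prime ideals and regular sequences *)

Section Ideals.
Variable R : comNzRingType.
Implicit Types (I J M P Q : set R) (s : seq R).

Lemma ideal_sum I (T : Type) (r : seq T) (Q : pred T) (F : T -> R) :
  is_ideal I -> (forall i, Q i -> I (F i)) -> I (\sum_(i <- r | Q i) F i).
Proof. by case=> I0 ID _ IF; elim/big_ind: _. Qed.

Lemma idealN I x : is_ideal I -> I x -> I (- x).
Proof. by case=> _ _ IM Ix; rewrite -mulN1r; apply: IM. Qed.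

Lemma idealB I x y : is_ideal I -> I x -> I y -> I (x - y).
Proof. by move=> idI Ix /(idealN idI); case: idI => _ + _; apply. Qed.

Lemma idealMr I r x : is_ideal I -> I x -> I (x * r).
Proof. by case=> _ _ IM Ix; rewrite mulrC; apply: IM. Qed.

Lemma ideal_gen_ideal s : is_ideal (ideal_gen s).
Proof.
split=> [|x y [c ->] [e ->]|r x [c ->]].
- by exists (fun=> 0); rewrite big1// => i _; rewrite mul0r.
- exists (fun i => c i + e i); rewrite -big_split.
  by apply: eq_bigr => i _; rewrite mulrDl.
- exists (fun i => r * c i); rewrite mulr_sumr.
  by apply: eq_bigr => i _; rewrite mulrA.
Qed.

Lemma mem_ideal_gen s x : x \in s -> ideal_gen s x.
Proof.
move=> xs; have xi : (index x s < size s)%N by rewrite index_mem.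
exists (fun i => (i == Ordinal xi)%:R).
rewrite (bigD1 (Ordinal xi))//= eqxx mul1r nth_index// big1 ?addr0//.
by move=> i /negbTE ->; rewrite mul0r.
Qed.

Lemma ideal_gen_sub s I :
  is_ideal I -> {in s, forall x, I x} -> ideal_gen s `<=` I.
Proof.
move=> idI sI x [c ->]; apply: ideal_sum => // i _.
by case: idI => _ _; apply; apply: sI; rewrite mem_nth.
Qed.

(** Zorn's lemma gives [P] maximal among the ideals that contain [I] and avoid [U]. If [x] and [y]
    lie outside [P], then enlarging [P] by either of them meets [U]; the product of the two elements
    so found is in [U], and it would be in [P] if [x * y] were. *)
Lemma prime_avoiding I (U : set R) : is_ideal I -> U 1 ->
    (forall x y, U x -> U y -> U (x * y)) -> (forall x, U x -> ~ I x) ->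
  exists P, [/\ is_prime_ideal P, I `<=` P & forall x, U x -> ~ P x].
Proof.
move=> idI U1 UM UI.
pose good J := [/\ is_ideal J, I `<=` J & forall x, U x -> ~ J x].
have [|P [Pgood Pmax]] := @Zorn_bigcup R (fun J => J = set0 \/ good J).
  move=> F FP Ftot; have [[J FJ J0]|F0] := pselect (exists2 J, F J & J <> set0);
    last first.
    left; rewrite -subset0 => x [J FJ Jx]; apply: F0.
    by exists J => // J0; rewrite J0 in Jx.
  have goodF J' x : F J' -> J' x -> good J'.
    by move=> FJ' J'x; case: (FP _ FJ') => // J'0; rewrite J'0 in J'x.
  have [J'0|[[I0 _ _] IJ UJ]] := FP _ FJ; first by [].
  right; split; [split| |].
  - by exists J.
  - move=> x y [A FA Ax] [B FB By].
    have [[_ AD _] _ _] := goodF _ _ FA Ax.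
    have [[_ BD _] _ _] := goodF _ _ FB By.
    have [AB|BA] := Ftot _ _ FA FB.
      by exists B => //; apply: BD => //; apply: AB.
    by exists A => //; apply: AD => //; apply: BA.
  - move=> r x [A FA Ax]; exists A => //.
    by have [[_ _ AM] _ _] := goodF _ _ FA Ax; apply: AM.
  - by move=> x Ix; exists J => //; apply: IJ.
  - by move=> x Ux [A FA Ax]; have [_ _ /(_ x Ux)] := goodF _ _ FA Ax.
have goodI : good I by split.
have [P0|{}Pgood] := Pgood.
  exfalso; apply: (Pmax I); last by right.
  rewrite P0; split=> // /(_ 0); apply; by case: idI.
have [idP IP UP] := Pgood; have [P0 PD PM] := idP.
exists P; split=> //; split=> //; first by apply: UP.
move=> x y Pxy; apply: contrapT => /not_orP[nPx nPy].
have meet z : ~ P z ->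
    exists2 u, U u & exists2 p, P p & exists r, u = p + r * z.
  move=> nPz; apply: contrapT => noU.
  pose J := [set w | exists2 p, P p & exists r, w = p + r * z].
  have PJ : P `<=` J.
    by move=> p Pp; exists p => //; exists 0; rewrite mul0r addr0.
  apply: (Pmax J).
    split=> // /(_ z); move=> JP; apply: nPz; apply: JP.
    by exists 0 => //; exists 1; rewrite mul1r add0r.
  right; split; [split|by apply: subset_trans PJ|].
  - exact: PJ.
  - move=> _ _ [p Pp [r ->]] [q Pq [t ->]]; exists (p + q); first exact: PD.
    by exists (r + t); rewrite mulrDl addrACA.
  - move=> t _ [p Pp [r ->]]; exists (t * p); first exact: PM.
    by exists (t * r); rewrite mulrDr mulrA.
  - move=> u Uu [p Pp [r uE]]; apply: noU.
    by exists u => //; exists p => //; exists r.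
have [u Uu [p Pp [r uE]]] := meet _ nPx.
have [v Uv [q Pq [t vE]]] := meet _ nPy.
apply: (UP _ (UM _ _ Uu Uv)); rewrite uE vE mulrDl !mulrDr.
do !apply: (PD); [exact: PM|exact: idealMr|exact: PM|].
by rewrite mulrACA; apply: PM.
Qed.

(** A prime that contains [M] and avoids 1 equals [M] by maximality. *)
Lemma maximal_prime M : is_maximal_ideal M -> is_prime_ideal M.
Proof.
case=> idM M1 Mmax.
have [|_ _ -> ->| |P [Pp MP UP]] := @prime_avoiding M [set 1] idM.
- by [].
- by rewrite mulr1.
- by move=> x ->.
have [idP P1 _] := Pp; by rewrite -(Mmax P).
Qed.

Lemma maximal_inv M x : is_maximal_ideal M -> ~ M x -> exists y, M (x * y - 1).
Proof.
case=> idM M1 Mmax nMx; have [M0 MD MM] := idM; apply: contrapT => ninv.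
pose J := [set w | exists2 p, M p & exists r, w = p + r * x].
have MJ : M `<=` J.
  by move=> p Pp; exists p => //; exists 0; rewrite mul0r addr0.
apply: nMx; rewrite -(Mmax J) //.
- by exists 0 => //; exists 1; rewrite mul1r add0r.
- split.
  + exact: MJ.
  + move=> _ _ [p Pp [r ->]] [q Pq [t ->]]; exists (p + q); first exact: MD.
    by exists (r + t); rewrite mulrDl addrACA.
  + move=> t _ [p Pp [r ->]]; exists (t * p); first exact: MM.
    by exists (t * r); rewrite mulrDr mulrA.
- case=> p Mp [r E]; apply: ninv; exists r.
  by rewrite E opprD addrCA mulrC subrr addr0; apply: idealN.
Qed.

Lemma prime_exp P x n : is_prime_ideal P -> P (x ^+ n) -> P x.
Proof.
case=> _ P1 PM; elim: n => [|n IHn]; first by rewrite expr0.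
by rewrite exprS => /PM[].
Qed.

Lemma prime_prod P (T : Type) (r : seq T) (Q : pred T) (F : T -> R) :
    is_prime_ideal P -> P (\prod_(i <- r | Q i) F i) ->
  exists2 i, Q i & P (F i).
Proof.
case=> _ P1 PM; elim/big_rec: _ => // i x Qi IHx /PM[Pi|/IHx//].
by exists i.
Qed.

(* Since [s_i] is a nonzerodivisor modulo [s_0, ..., s_(i-1)], the
   multiplicative set generated by [s_i] and the complement of a prime [Q]
   containing that ideal avoids it: there is a prime below [Q] that contains
   the ideal but not [s_i]. *)
Lemma regular_prime_chain s Q : is_prime_ideal Q -> {in s, forall x, Q x} ->
    (forall i, (i < size s)%N -> forall y,
      ideal_gen (take i s) (s`_i * y) -> ideal_gen (take i s) y) ->
  exists P : nat -> set R, prime_chain P (size s) /\ P (size s) = Q.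
Proof.
elim/last_ind: s Q => [|s x IHs] Q Qp sQ reg.
  by exists (fun=> Q); split.
have [idQ Q1 QM] := Qp.
have subQ : ideal_gen s `<=` Q.
  by apply: ideal_gen_sub => // y ys; apply: sQ; rewrite mem_rcons inE ys orbT.
have regx y : ideal_gen s (x * y) -> ideal_gen s y.
  have := reg (size s); rewrite size_rcons ltnSn => /(_ isT y).
  by rewrite -cats1 take_size_cat// nth_cat ltnn subnn.
pose U := [set w | exists k y, w = x ^+ k * y /\ ~ Q y].
have [| | | |P' [P'p sP' UP']] := @prime_avoiding (ideal_gen s) U.
- exact: ideal_gen_ideal.
- by exists 0%N, 1; rewrite mulr1.
- move=> _ _ [k [y [-> nQy]]] [m [z [-> nQz]]]; exists (k + m)%N, (y * z).
  by split; [rewrite exprD mulrACA|case/QM].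
- move=> _ [k [y [-> nQy]]] gxy; apply/nQy/subQ.
  by elim: k gxy => [|k IHk]; rewrite ?mul1r// exprS -mulrA => /regx.
have P'Q : P' `<=` Q.
  move=> y P'y; apply: contrapT => nQy; apply: UP' P'y.
  by exists 0%N, y; rewrite mul1r.
have nP'x : ~ P' x by apply: UP'; exists 1%N, 1; rewrite mulr1.
have Qx : Q x by apply: sQ; rewrite mem_rcons inE eqxx.
have [|i lti y|P [[Pprime Plt] PE]] := IHs P' P'p.
- by move=> y ys; apply/sP'/mem_ideal_gen.
- have := reg i; rewrite size_rcons ltnS (ltnW lti) => /(_ isT y).
  by rewrite -cats1 take_cat lti nth_cat lti.
exists (fun i => if (i <= size s)%N then P i else Q).
rewrite size_rcons ltnn; split=> //; split=> i lei.
  by case: ifP => // /Pprime.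
rewrite ltnS in lei; rewrite lei; case: ifP => [/Plt//|/negbT].
rewrite -leqNgt => lei'; have -> : i = size s by apply/eqP; rewrite eqn_leq lei.
by rewrite PE; split=> // /(_ x Qx).
Qed.

End Ideals.

(** * The Hilbert basis theorem *)

Lemma seq_preimage (T U : eqType) (h : U -> T) (G : set U) (s : seq T) :
    {in s, forall a, exists2 x, G x & h x = a} ->
  exists2 t, {in t, forall x, G x} & s = map h t.
Proof.
elim: s => [|a s IHs] Gs; first by exists [::].
have [x Gx <-] := Gs _ (mem_head _ _).
have [|t Gt ->] := IHs; first by move=> b bs; apply: Gs; rewrite inE bs orbT.
by exists (x :: t) => // y; rewrite inE => /predU1P[->|/Gt].
Qed.

Lemma noetherian_field (K : fieldType) : noetherian K.
Proof.
move=> I [I0 ID IM]; have [[x Ix x0]|noI] := pselect (exists2 x, I x & x != 0).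
  exists [:: 1]; rewrite eqEsubset; split=> y _.
    by exists (fun=> y); rewrite big_ord1 mulr1.
  by rewrite -(mulfVK x0 y); apply: IM.
exists [::]; rewrite eqEsubset; split=> y.
  move=> Iy; exists (fun=> 0); rewrite big_ord0; apply: contrapT => /eqP y0.
  by apply: noI; exists y.
by case=> c ->; rewrite big_ord0.
Qed.

Section HilbertBasis.
Variable R : comNzRingType.
Hypothesis noethR : noetherian R.
Variable I : set {poly R}.
Hypothesis idI : is_ideal I.

(** The coefficients at ['X^N] of the elements of [I] of size at most [N.+1] form an ideal of [R].
    Subtracting a combination of lifts of its generators lowers the size, which leads back to the
    generators found for [N]. *)
Lemma bounded_size_generators N : exists2 L : seq {poly R},
  {in L, forall g, I g} & forall f, I f -> (size f <= N)%N -> ideal_gen L f.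
Proof.
have [I0 ID IM] := idI; elim: N => [|N [L IL genL]].
  exists [::] => // f _; rewrite leqn0 size_poly_eq0 => /eqP ->.
  by exists (fun=> 0); rewrite big_ord0.
pose G := [set f : {poly R} | I f /\ (size f <= N.+1)%N].
pose J := [set a | exists2 f, G f & f`_N = a].
have idJ : is_ideal J.
  split.
  - by exists 0; rewrite ?coef0//; split; rewrite ?size_poly0.
  - move=> _ _ [f [If sf] <-] [g [Ig sg] <-]; exists (f + g); rewrite ?coefD//.
    split; first exact: ID.
    by apply: leq_trans (size_polyD _ _) _; rewrite geq_max sf.
  - move=> r _ [f [If sf] <-]; exists (r%:P * f); rewrite ?coefCM//.
    split; first exact: IM.
    by rewrite mul_polyC; apply: leq_trans (size_scale_leq _ _) sf.
have [s Js] := noethR idJ.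
have [t Gt st] : exists2 t : seq {poly R},
    {in t, forall f, G f} & s = map (coefp N) t.
  by apply: seq_preimage => a /mem_ideal_gen; rewrite -Js.
exists (t ++ L) => [g|f If sf].
  by rewrite mem_cat => /orP[/Gt[]|/IL].
have : J f`_N by exists f.
rewrite Js => -[c fN]; rewrite st size_map in c fN.
have idtL := ideal_gen_ideal (t ++ L).
pose h := \sum_(i < size t) (c i)%:P * t`_i.
rewrite -(subrK h f); have [_ + _] := idtL; apply; last first.
  apply: ideal_sum => // i _; have [_ _] := idtL; apply.
  by apply: mem_ideal_gen; rewrite mem_cat mem_nth.
have ti i : G t`_i -> forall j, (N < j)%N -> (t`_i)`_j = 0.
  by case=> _ si j; move/(leq_trans si)/leq_sizeP; apply.
have : ideal_gen L (f - h).
  apply: genL.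
    apply: idealB => //; apply: ideal_sum => // i _; apply: IM.
    by case: (Gt t`_i); rewrite ?mem_nth.
  apply/leq_sizeP => j; rewrite coefB coef_sum leq_eqVlt => /predU1P[<-|Nj].
    rewrite fN -sumrB big1// => i _.
    by rewrite coefCM (nth_map 0)// subrr.
  rewrite (leq_sizeP _ _ sf)// big1 ?subr0// => i _.
  by rewrite coefCM ti ?mulr0//; apply: Gt; rewrite mem_nth.
apply: ideal_gen_sub => // g gL; apply: mem_ideal_gen.
by rewrite mem_cat gL orbT.
Qed.

(** Hilbert's argument: above the largest degree [N] of the lifted generators of the leading
    coefficients, multiples of the lifts reduce the size; at size at most [N],
    [bounded_size_generators] takes over. *)
Lemma ideal_poly_fg : exists s, I = ideal_gen s.
Proof.
have [I0 ID IM] := idI.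
(* The second component is a formal degree that may exceed the true one. A vanishing top coefficient
   is thus allowed, and [J] is closed under addition. *)
pose G := [set u : {poly R} * nat | I u.1 /\ (size u.1 <= u.2.+1)%N].
pose J := [set a | exists2 u : {poly R} * nat, G u & u.1`_u.2 = a].
have idJ : is_ideal J.
  split.
  - by exists (0, 0%N); rewrite ?coef0//; split; rewrite ?size_poly0.
  - move=> _ _ [[f n] [/= If sf] <-] [[g m] [/= Ig sg] <-].
    (* Powers of ['X] bring both summands to the formal degree [n + m]. *)
    exists (f * 'X^m + g * 'X^n, (n + m)%N); last first.
      by rewrite coefD !coefMXn !ltnNge leq_addl leq_addr addnK addKn.
    split=> /=; first by apply: ID; apply: idealMr.
    apply: leq_trans (size_polyD _ _) _; rewrite geq_max; apply/andP; split.
      apply: leq_trans (size_polyMleq _ _) _.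
      by rewrite size_polyXn addnS /= -addSn leq_add2r.
    apply: leq_trans (size_polyMleq _ _) _.
    by rewrite size_polyXn addnS /= addnC -addnS leq_add2l.
  - move=> r _ [[f n] [/= If sf] <-]; exists (r%:P * f, n); rewrite ?coefCM//.
    split; first exact: IM.
    by rewrite /= mul_polyC; apply: leq_trans (size_scale_leq _ _) sf.
have [s Js] := noethR idJ.
have [t Gt st] : exists2 t : seq ({poly R} * nat),
    {in t, forall u, G u} & s = map (fun u : {poly R} * nat => u.1`_u.2) t.
  by apply: seq_preimage => a /mem_ideal_gen; rewrite -Js.
pose N := (\max_(u <- t) u.2)%N.
have [L IL genL] := bounded_size_generators N.
have idtL := ideal_gen_ideal (map fst t ++ L).
have It : {in map fst t ++ L, forall g, I g}.
  by move=> g; rewrite mem_cat => /orP[/mapP[u /Gt[? _] ->]|/IL].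
exists (map fst t ++ L); rewrite eqEsubset; split; last exact: ideal_gen_sub.
move=> f; have := leqnn (size f); move: {2}(size f) => k.
elim: k f => [|k IHk] f sf If.
  move: sf; rewrite leqn0 size_poly_eq0 => /eqP ->; by case: idtL.
have [kN|Nk] := leqP k.+1 N.
  have := genL f If (leq_trans sf kN).
  apply: ideal_gen_sub => // g gL; apply: mem_ideal_gen.
  by rewrite mem_cat gL orbT.
have : J f`_k by exists (f, k).
rewrite Js => -[c fk]; rewrite st size_map in c fk.
pose u0 : {poly R} * nat := (0, 0%N).
pose h := \sum_(i < size t) (c i)%:P * 'X^(k - (nth u0 t i).2) * (nth u0 t i).1.
have lek i : (i < size t)%N -> ((nth u0 t i).2 <= k)%N.
  move=> it; rewrite -ltnS (leq_ltn_trans _ Nk)// /N.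
  by apply: leq_bigmax_seq => //; rewrite mem_nth.
rewrite -(subrK h f); have [_ + _] := idtL; apply; last first.
  apply: ideal_sum => // i _; have [_ _] := idtL; apply.
  by apply: mem_ideal_gen; rewrite mem_cat map_f// mem_nth.
apply: IHk.
  apply/leq_sizeP => j; rewrite coefB coef_sum leq_eqVlt => /predU1P[<-|kj].
    rewrite fk -sumrB big1// => i _; rewrite -mulrA coefCM coefXnM.
    by rewrite ltnNge leq_subr subKn ?lek// (nth_map u0)// subrr.
  rewrite (leq_sizeP _ _ sf)// big1 ?subr0// => i _.
  rewrite -mulrA coefCM coefXnM.
  have [_ /leq_sizeP si] : G (nth u0 t i) by apply: Gt; rewrite mem_nth.
  case: ltnP => ltj; first by rewrite mulr0.
  by rewrite si ?mulr0// ltn_subRL; move: (lek i (ltn_ord i)) kj; lia.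
apply: idealB => //; apply: ideal_sum => // i _; apply: IM.
by case: (Gt (nth u0 t i)); rewrite ?mem_nth.
Qed.
End HilbertBasis.

Lemma hilbert_basis (R : comNzRingType) : noetherian R -> noetherian {poly R}.
Proof. by move=> noethR I idI; apply: ideal_poly_fg. Qed.

Lemma noetherian_surj (R B : comNzRingType) (f : {rmorphism R -> B}) :
  (forall y, exists x, f x = y) -> noetherian R -> noetherian B.
Proof.
move=> fsurj noethR I idI; have [I0 ID IM] := idI.
have [|s fIs] := noethR (f @^-1` I).
  split=> [|x y|r x]; rewrite /preimage/= ?rmorph0 ?rmorphD ?rmorphM//.
    exact: ID.
  exact: IM.
exists (map f s); rewrite eqEsubset; split.
  move=> y; have [x <-] := fsurj y => Ifx.
  have [c ->] : ideal_gen s x by rewrite -fIs.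
  rewrite rmorph_sum; apply: ideal_sum => [|i _]; first exact: ideal_gen_ideal.
  rewrite rmorphM; have [_ _] := ideal_gen_ideal (map f s); apply.
  by apply: mem_ideal_gen; rewrite map_f ?mem_nth.
apply: ideal_gen_sub => // _ /mapP[x xs ->].
by have : (f @^-1` I) x by rewrite fIs; apply: mem_ideal_gen.
Qed.

(** Finite generation as an algebra, encoded as an induction principle; this avoids polynomials in
    several variables, as [generates_cons] adjoins one variable at a time. *)
Definition generates (R B : comNzRingType) (phi : R -> B) (ys : seq B) :=
  forall Z : set B, (forall r, Z (phi r)) -> {in ys, forall y, Z y} ->
    (forall x y, Z x -> Z y -> Z (x + y)) ->
    (forall x y, Z x -> Z y -> Z (x * y)) -> forall z, Z z.

Section Generates.
Variables (R B : comNzRingType) (phi : {rmorphism R -> B}).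

Definition eval_at (y : B) : {poly R} -> B :=
  horner_morph (fun r : R => mulrC y (phi r)).
HB.instance Definition _ y := GRing.RMorphism.on (eval_at y).

Lemma eval_atE y p : eval_at y p = (map_poly phi p).[y].
Proof. by []. Qed.

Lemma eval_atC y r : eval_at y r%:P = phi r.
Proof. exact: horner_morphC. Qed.

Lemma eval_atX y : eval_at y 'X = y.
Proof. exact: horner_morphX. Qed.

Lemma generates_nil : generates phi [::] -> forall z, exists r, phi r = z.
Proof.
move=> gen; apply: (gen [set z | exists r, phi r = z]) => //=.
- by move=> r; exists r.
- by move=> _ _ [r <-] [t <-]; exists (r + t); rewrite rmorphD.
- by move=> _ _ [r <-] [t <-]; exists (r * t); rewrite rmorphM.
Qed.

(** Moving one generator into the base ring is the inductive step of both [noetherian_generated] and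
    [gdomain_generated]. *)
Lemma generates_cons y ys :
  generates phi (y :: ys) -> generates (eval_at y) ys.
Proof.
move=> gen Z Zev Zys; apply: gen => [r|x].
  by rewrite -(eval_atC y); apply: Zev.
by rewrite inE => /predU1P[->|/Zys//]; rewrite -[y in Z y]eval_atX; apply: Zev.
Qed.

Lemma generates_surj (F : comNzRingType) (f : {rmorphism B -> F}) ys :
  (forall z, exists x, f x = z) -> generates phi ys ->
  generates (f \o phi) (map f ys).
Proof.
move=> fsurj gen Z Zphi Zys ZD ZM z; have [x <-] := fsurj z.
apply: (gen (f @^-1` Z)) => [r|y /(map_f f)/Zys//|u v|u v].
- exact: Zphi.
- by rewrite /preimage/= rmorphD; apply: ZD.
- by rewrite /preimage/= rmorphM; apply: ZM.
Qed.

End Generates.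

Lemma noetherian_generated (R B : comNzRingType) (phi : {rmorphism R -> B}) ys :
  generates phi ys -> noetherian R -> noetherian B.
Proof.
elim: ys R phi => [|y ys IHys] R phi gen noethR.
  exact: noetherian_surj (generates_nil gen) noethR.
exact: IHys _ _ (generates_cons gen) (hilbert_basis noethR).
Qed.

(** * Zariski's lemma *)

Section Integral.
Variables (R : comNzRingType) (F : fieldType) (psi : {rmorphism R -> F}).

Lemma integral_poly_rmorph (p : {poly R}) :
  {in (map_poly psi p : seq F), integralRange psi}.
Proof. by apply/integral_poly => i; rewrite coef_map; apply: integral_id. Qed.

Lemma integral_exp z n : integralOver psi z -> integralOver psi (z ^+ n).
Proof.
move=> intz; elim: n => [|n IHn]; first exact: integral1.
by rewrite exprS; apply: integral_mul.
Qed.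

(* [lead_coef p ^ (n-1) * p (X / lead_coef p)] is monic, with coefficients in
   the subring generated by those of [p]. *)
Lemma lead_coef_mul_integral (p : {poly R}) y (p' := map_poly psi p) :
  p' != 0 -> root p' y -> integralOver psi (lead_coef p' * y).
Proof.
move=> p'0 py; set a := lead_coef p'.
have a0 : a != 0 by rewrite lead_coef_eq0.
have := root_size_gt1 p'0 py; case sp: (size p') => [|[|n]]// _.
pose E i := a ^+ n * a ^- i * p'`_i.
have E1 : E n.+1 = 1.
  rewrite /E.
  have -> : p'`_n.+1 = a by rewrite /a /lead_coef sp.
  by rewrite -mulrA [_ * a]mulrC mulrA -exprSr divff// expf_neq0.
pose q := \poly_(i < n.+2) E i.
apply: (@integral_root_monic _ _ _ _ q).
- apply/monicP; have E1n : E n.+2.-1 != 0 by rewrite E1 oner_eq0.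
  by rewrite (lead_coef_poly _ E1n)//; exact: E1.
- apply/rootP; rewrite horner_poly.
  transitivity (a ^+ n * p'.[y]); last by rewrite (rootP py) mulr0.
  rewrite horner_coef mulr_sumr sp; apply: eq_bigr => i _.
  rewrite /E exprMn; have := expf_neq0 i a0.
  by move: (a ^+ i) => A A0; field.
apply/integral_poly => i; rewrite coef_poly; case: ltnP => _;
  last exact: integral0.
have psiint j : integralOver psi p'`_j by rewrite coef_map; apply: integral_id.
have [->|i_n] := eqVneq i n.+1; first by rewrite E1; apply: integral1.
have [lein|gtin] := leqP i n; last first.
  rewrite /E [p'`_i]nth_default ?mulr0; first exact: integral0.
  by rewrite sp ltn_neqAle eq_sym i_n.
rewrite /E -expfB_cond ?(negbTE a0)//; apply: integral_mul => //.
by apply: integral_exp; apply: psiint.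
Qed.

(** If a relation of [z] has constant term [c] with [psi c != 0], then [psi c / z] is a polynomial
    in [z], hence integral. If [psi c] vanishes, the relation can be divided by the variable. *)
Lemma integral_inv_mul z : z != 0 -> integralOver psi z ->
  exists2 b, psi b != 0 & integralOver psi (psi b / z).
Proof.
move=> z0 intz; have [q mq] := intz.
have: map_poly psi q != 0 by rewrite monic_neq0// monic_map.
elim/poly_ind: q {mq} => [|q c IHq]; first by rewrite rmorph0 eqxx.
rewrite rmorphD rmorphM/= map_polyX map_polyC/= => q0 /rootP.
rewrite hornerD hornerMX hornerC => qz.
have [c0|c0] := eqVneq (psi c) 0.
  apply: IHq; first by apply: contraNneq q0 => ->; rewrite c0 mul0r add0r.
  by move/eqP: qz; rewrite c0 addr0 mulf_eq0 (negbTE z0) orbF.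
exists c => //; have -> : psi c = - (map_poly psi q).[z] * z.
  by rewrite mulNr; apply/eqP; rewrite -addr_eq0 addrC qz.
rewrite mulfK//; apply: integral_opp; apply: integral_horner => //.
exact: integral_poly_rmorph.
Qed.

(** In the monic relation of [psi c / psi r], clearing denominators leaves a power of [c] on one
    side and a multiple of [r] on the other. *)
Lemma integral_div_dvd c r : psi r != 0 -> integralOver psi (psi c / psi r) ->
  exists s k, psi (r * s) = psi c ^+ k.
Proof.
move=> r0 [q mq qe]; have mq' : map_poly psi q \is monic by rewrite monic_map.
have := root_size_gt1 (monic_neq0 mq') qe.
case sq: (size (map_poly psi q)) => [|[|m]]// _.
move: qe => /rootP; rewrite horner_coef sq big_ord_recr/=.
have -> : (map_poly psi q)`_m.+1 = 1.
  by move/monicP: mq'; rewrite /lead_coef sq.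
rewrite mul1r addrC => /eqP; rewrite addr_eq0 => /eqP E.
exists (- \sum_(i < m.+1) q`_i * c ^+ i * r ^+ (m - i)), m.+1.
have -> : psi c ^+ m.+1 = (psi c / psi r) ^+ m.+1 * psi r ^+ m.+1.
  by rewrite -exprMn divfK.
rewrite E rmorphM rmorphN rmorph_sum/= mulrN mulNr; congr (- _).
rewrite mulr_sumr mulr_suml; apply: eq_bigr => i _.
rewrite !rmorphM !rmorphXn/= coef_map/= exprMn exprVn.
have -> : psi r ^+ m.+1 = psi r ^+ i * (psi r * psi r ^+ (m - i)).
  by rewrite -exprS -exprD addnS subnKC// -ltnS.
have : psi r ^+ i != 0 by rewrite expf_neq0.
by move: (psi r ^+ i) => x x0; rewrite /=; field.
Qed.

End Integral.

(* The image of [phi] becomes a field after inverting a single element. *)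
Definition gdomain (R : comNzRingType) (F : fieldType) (phi : R -> F) :=
  exists2 u, phi u != 0 &
    forall r, phi r != 0 -> exists s k, phi (r * s) = phi u ^+ k.

Section Goldman.
Variables (R : comNzRingType) (F : fieldType) (psi : {rmorphism R -> F}).
Variable y : F.
Hypothesis gdom : gdomain (eval_at psi y).

(* If the kernel of [eval_at psi y] were that of [map_poly psi], then
   [1 + 'X * u] would divide a power of [u] in [{poly F}], although it is coprime
   to [u]. *)
Lemma gdomain_algebraic :
  exists2 p : {poly R}, map_poly psi p != 0 & root (map_poly psi p) y.
Proof.
have [u u0 udiv] := gdom; apply: contrapT => trans.
have kermap p : eval_at psi y p = 0 -> map_poly psi p = 0.
  move=> p0; apply/eqP/negPn/negP => p'0; apply: trans; exists p => //.
  by apply/rootP; rewrite -eval_atE.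
pose u' := map_poly psi u; pose v := 1 + 'X * u; pose v' := 1 + 'X * u'.
have vE : map_poly psi v = v' by rewrite /v rmorphD rmorph1 rmorphM/= map_polyX.
have u'0 : u' != 0.
  by apply: contraNneq u0; rewrite eval_atE -/u' => ->; rewrite horner0.
have sv : (1 < size v')%N.
  have sXu : size ('X * u') = (size u').+1 by rewrite mulrC size_mulX.
  by rewrite /v' addrC size_polyDl sXu ?size_poly1 ltnS size_poly_gt0.
have v0 : eval_at psi y v != 0.
  by apply/eqP => /kermap; rewrite vE => v'0; rewrite v'0 size_poly0 in sv.
have [s [k svk]] := udiv _ v0.
have : v' %| u' ^+ k.
  apply/dvdpP; exists (map_poly psi s); rewrite mulrC -vE -rmorphM -rmorphXn/=.
  apply/esym/eqP; rewrite -subr_eq0 -rmorphB; apply/eqP/kermap.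
  by rewrite rmorphB rmorphXn/= svk subrr.
have cop : coprimep v' (u' ^+ k).
  apply: coprimep_expr; rewrite coprimep_sym; apply/Bezout_coprimepP.
  by exists (- 'X, 1) => /=; rewrite mul1r mulNr addrC addrK eqpxx.
move=> /coprimep_dvdl/(_ cop); rewrite coprimepp.
by case: eqP sv => // ->.
Qed.

(** The element to invert is [alpha * beta]: [alpha] makes [y] integral, and [beta] makes the
    inverse of [z], a multiple of the value of [u], integral. For [r] with nonzero image, a power of
    [alpha * beta] divided by [r] is then integral, so [integral_div_dvd] applies. *)
Lemma gdomain_descends : gdomain psi.
Proof.
have [u u0 udiv] := gdom; have [p p0 py] := gdomain_algebraic.
(* The index is read off the image, since [psi] may kill the leading coefficient of [p]. *)
set alpha := p`_(size (map_poly psi p)).-1.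
have psi_alpha : psi alpha = lead_coef (map_poly psi p).
  by rewrite /alpha /lead_coef coef_map.
have alpha0 : psi alpha != 0 by rewrite psi_alpha lead_coef_eq0.
have alphay : integralOver psi (psi alpha * y).
  by rewrite psi_alpha; apply: lead_coef_mul_integral.
(* A power of [alpha] compensates for each occurrence of [y]. *)
have ev_int q : exists N, integralOver psi (psi alpha ^+ N * eval_at psi y q).
  elim/poly_ind: q => [|q c [N IHq]].
    by exists 0%N; rewrite rmorph0 mulr0; apply: integral0.
  exists N.+1; rewrite rmorphD rmorphM/= eval_atX eval_atC mulrDr.
  apply: integral_add; last first.
    by rewrite -rmorphXn -rmorphM; apply: integral_id.
  by rewrite exprSr mulrACA; apply: integral_mul.
have [N intz] := ev_int u; set z := _ * _ in intz.
have z0 : z != 0 by rewrite mulf_neq0// expf_neq0.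
have [beta beta0 betaz] := integral_inv_mul z0 intz.
exists (alpha * beta) => [|r r0]; first by rewrite rmorphM mulf_neq0.
have [|s [k rs]] := udiv r%:P; first by rewrite eval_atC.
have [M intM] := ev_int s.
suff [t [l]] : exists t l, psi (r * t) = psi ((alpha * beta) ^+ (k + M)) ^+ l.
  by move=> rt; exists t, ((k + M) * l)%N; rewrite rt rmorphXn exprM.
apply: integral_div_dvd => //.
(* The quotient is split into factors that are integral by [betaz], by [intM], and as an image of
   [psi]. *)
have -> : psi ((alpha * beta) ^+ (k + M)) / psi r =
  (psi beta / z) ^+ k * (psi alpha ^+ M * eval_at psi y s)
    * psi (alpha ^+ (N * k + k) * beta ^+ M).
  have -> : eval_at psi y s = eval_at psi y u ^+ k / psi r.
    by rewrite -rs rmorphM/= eval_atC mulrAC divff// mul1r.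
  rewrite /z !rmorphM !rmorphXn !rmorphM/=.
  rewrite !exprD !exprMn !exprVn !exprMn -!exprM.
  move: (psi alpha ^+ (N * k)) (expf_neq0 (N * k) alpha0) => A A0.
  move: (eval_at psi y u ^+ k) (expf_neq0 k u0) => U U0.
  by field; rewrite A0 U0 r0.
apply: integral_mul; last exact: integral_id.
by apply: integral_mul => //; apply: integral_exp.
Qed.

End Goldman.

(** With no generator left the image is all of [F], and 1 serves as the element to invert;
    [gdomain_descends] then removes the adjoined elements one by one. *)
Lemma gdomain_generated (R : comNzRingType) (F : fieldType)
  (phi : {rmorphism R -> F}) ys : generates phi ys -> gdomain phi.
Proof.
elim: ys R phi => [|y ys IHys] R phi gen.
  exists 1 => [|r r0]; first by rewrite rmorph1 oner_eq0.
  have [s sr] := generates_nil gen (phi r)^-1; exists s, 0%N.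
  by rewrite rmorphM sr divff.
exact: gdomain_descends (IHys _ _ (generates_cons gen)).
Qed.

(** With [y] itself placed in front of the generators, the image of [K[y]] satisfies [gdomain],
    which forces [y] to be algebraic. *)
Lemma zariski (K F : fieldType) (phi : {rmorphism K -> F}) ys (y : F) :
  generates phi ys -> exists2 p : {poly K}, p != 0 & root (map_poly phi p) y.
Proof.
move=> gen; have genev : generates (eval_at phi y) ys.
  apply: generates_cons => Z Zphi Zys; apply: gen => // x xs.
  by apply: Zys; rewrite inE xs orbT.
have [p p0 py] := gdomain_algebraic (gdomain_generated genev).
by exists p => //; apply: contraNneq p0 => ->; rewrite rmorph0.
Qed.

(** * The residue field of a maximal ideal *)

Section ResidueField.
Variables (R : comNzRingType) (M : set R).
Hypothesis maxM : is_maximal_ideal M.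

Definition residue_pred : {pred R} := fun x => `[< M x >].

Lemma residue_idealr_closed : idealr_closed residue_pred.
Proof.
have [idM M1 _] := maxM; have [M0 MD MM] := idM.
split=> [||a x y /asboolP Mx /asboolP My]; [exact/asboolP|exact/asboolP|].
by apply/asboolP/MD => //; apply: MM.
Qed.
HB.instance Definition _ := isIdealr.Build R residue_pred residue_idealr_closed.

Local Open Scope quotient_scope.

Definition residue : Type := {ideal_quot residue_pred}.
HB.instance Definition _ := GRing.ComNzRing.on residue.

Definition residue_pi (x : R) : residue := \pi_({ideal_quot residue_pred}) x.

Lemma residue_pi_zmod : zmod_morphism residue_pi.
Proof. exact: raddfB. Qed.
Lemma residue_pi_monoid : monoid_morphism residue_pi.
Proof. by split; [exact: rmorph1|exact: rmorphM]. Qed.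
HB.instance Definition _ := GRing.isZmodMorphism.Build R residue residue_pi
  residue_pi_zmod.
HB.instance Definition _ := GRing.isMonoidMorphism.Build R residue residue_pi
  residue_pi_monoid.

Lemma residue_pi_surj z : exists x, residue_pi x = z.
Proof. by exists (repr z); apply: reprK. Qed.

Lemma residue_pi_eq0 x : residue_pi x = 0 <-> M x.
Proof.
rewrite -(rmorph0 residue_pi); split=> [/eqP|Mx].
  by rewrite -Quotient.idealrBE subr0 => /asboolP.
by apply/eqP; rewrite -Quotient.idealrBE subr0; apply/asboolP.
Qed.

Definition residue_inv (z : residue) : residue :=
  if z == 0 then 0 else xget 0 [set w : residue | w * z = 1].

Lemma residue_mulVf z : z != 0 -> residue_inv z * z = 1.
Proof.
move=> z0; rewrite /residue_inv (negbTE z0); case: xgetP => [w _ //|].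
have [x zE] := residue_pi_surj z; subst z.
have [|y Mxy] := @maximal_inv _ _ x maxM.
  by move/residue_pi_eq0 => x0; rewrite x0 eqxx in z0.
move=> /(_ (residue_pi y)) []; apply/eqP; rewrite -subr_eq0 mulrC -rmorphM.
by rewrite -(rmorph1 residue_pi) -rmorphB; apply/eqP/residue_pi_eq0.
Qed.

Lemma residue_inv0 : residue_inv 0 = 0.
Proof. by rewrite /residue_inv eqxx. Qed.

HB.instance Definition _ := GRing.ComNzRing_isField.Build residue
  residue_mulVf residue_inv0.

(** The class of [x] is algebraic over [K] by Zariski's lemma, and its relation pulls back to an
    element of [M]. *)
Lemma residue_algebraic (K : fieldType) (phi : {rmorphism K -> R}) ys x :
  generates phi ys ->
  exists2 p : {poly K}, p != 0 & M (map_poly phi p).[x].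
Proof.
move=> /(generates_surj residue_pi_surj) gen.
have [p p0 /rootP px] := zariski (residue_pi x) gen.
exists p => //; apply/residue_pi_eq0; rewrite -horner_map/= -map_poly_comp.
exact: px.
Qed.

End ResidueField.

(** * The dimension of semigroup rings *)

Lemma linear_dependence (K : fieldType) (I J : finType) (A : I -> J -> K) :
  (#|J| < #|I|)%N ->
  exists2 c : I -> K, exists i, c i != 0 & forall j, \sum_i c i * A i j = 0.
Proof.
move=> JI; pose M := \matrix_(i < #|I|, j < #|J|) A (enum_val i) (enum_val j).
have : kermx M != 0.
  rewrite -mxrank_eq0 mxrank_ker subn_eq0 -ltnNge.
  exact: leq_ltn_trans (rank_leq_col _) JI.
case/rowV0Pn => v /sub_kermxP vM /rV0Pn[i0 vi0].
exists (fun i => v 0 (enum_rank i)) => [|j].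
  by exists (enum_val i0); rewrite enum_valK.
move/matrixP: vM => /(_ 0 (enum_rank j)); rewrite !mxE => vMj.
rewrite -[RHS]vMj.
rewrite (reindex (@enum_val I predT)) /=; last exact/onW_bij/enum_val_bij.
by apply: eq_bigr => i _; rewrite enum_valK !mxE !enum_rankK.
Qed.

(* With [x i] in [P i.+1] but not in [P i], an algebraic relation modulo [P 0]
   is impossible: modulo [P k], divide by the largest power of [x k] and keep
   the terms that do not involve [x k] any more, which form a relation modulo
   [P k.+1]. *)
Lemma prime_chain_independent (K : fieldType) (R : comNzRingType)
    (phi : {rmorphism K -> R}) (P : nat -> set R) n (x : 'I_n -> R) N
    (c : {ffun 'I_n -> 'I_N} -> K) :
    prime_chain P n -> (forall i : 'I_n, P i.+1 (x i) /\ ~ P i (x i)) ->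
    P 0%N (\sum_a phi (c a) * \prod_i x i ^+ a i) ->
  forall a, c a = 0.
Proof.
move=> chainP xP P0 a0; apply/eqP/negPn/negP => ca0.
have [Pp Plt] := chainP.
have idealP k : (k <= n)%N -> is_ideal (P k) by move=> /Pp[].
(* The set [J] collects the exponents of the terms that survive up to stage [k]. At [k = n] it is a
   singleton, so a nonzero scalar would lie in [P n]. *)
have term k : (k <= n)%N -> exists2 J : {set {ffun 'I_n -> 'I_N}},
    J != finset.set0 /\ {in J, forall a, c a != 0} &
    {in J &, forall a b : {ffun 'I_n -> 'I_N},
      forall i : 'I_n, (i < k)%N -> a i = b i} /\
    P k (\sum_(a in J) phi (c a) * \prod_(i < n | (k <= i)%N) x i ^+ a i).
  elim: k => [_|k IHk kn].
    exists (finset.finset (fun a => c a != 0)).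
      split; last by move=> a; rewrite inE.
      by apply/set0Pn; exists a0; rewrite inE.
    split=> //; have -> // : \sum_(a in finset.finset (fun a => c a != 0))
      phi (c a) * \prod_(i < n | (0 <= i)%N) x i ^+ a i =
      \sum_a phi (c a) * \prod_i x i ^+ a i.
    rewrite [RHS](bigID (fun a => c a != 0))/= [X in _ + X]big1 ?addr0.
      by apply: eq_bigl => a; rewrite inE.
    by move=> a /negPn/eqP ->; rewrite rmorph0 mul0r.
  have [J [/set0Pn[a1 a1J] Jc] [Jeq PJ]] := IHk (ltnW kn).
  pose i0 := Ordinal kn.
  have [b bJ bmin] : exists2 b, b \in J &
      {in J, forall a : {ffun 'I_n -> 'I_N}, (b i0 <= a i0)%N}.
    by have [b] := @arg_minnP _ a1 (mem J) (fun a => a i0) a1J; exists b.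
  have [Pxk1 nPxk] := xP i0.
  pose rest (a : {ffun 'I_n -> 'I_N}) := \prod_(i < n | (k < i)%N) x i ^+ a i.
  have {}PJ : P k (\sum_(a in J) phi (c a) * (x i0 ^+ (a i0 - b i0) * rest a)).
    have [_ _ PM] := Pp k (ltnW kn).
    have : P k (x i0 ^+ b i0 *
        \sum_(a in J) phi (c a) * (x i0 ^+ (a i0 - b i0) * rest a)).
      rewrite mulr_sumr; set s := (X in P k X).
      move: PJ; set s' := (X in P k X).
      suff -> : s = s' by [].
      apply: eq_bigr => a aJ; rewrite mulrCA; congr (_ * _).
      rewrite mulrA -exprD subnKC; last exact: bmin.
      rewrite [RHS](bigD1 i0)//=; congr (_ * _); apply: eq_bigl => i.
      by rewrite ltn_neqAle andbC eq_sym.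
    by case/PM => // /(prime_exp (Pp k (ltnW kn))).
  exists (finset.finset (fun a => (a \in J) && (a i0 == b i0))).
    split; last by move=> a; rewrite inE => /andP[/Jc].
    by apply/set0Pn; exists b; rewrite inE bJ eqxx.
  split.
    move=> a a'; rewrite !inE => /andP[aJ /eqP ab] /andP[a'J /eqP a'b] i.
    rewrite ltnS leq_eqVlt => /predU1P[ik|]; last exact: Jeq.
    have -> : i = i0 by apply: val_inj.
    by rewrite ab a'b.
  have {}PJ :
      P k.+1 (\sum_(a in J) phi (c a) * (x i0 ^+ (a i0 - b i0) * rest a)).
    by case: (Plt k kn) => + _; apply.
  move: PJ; rewrite (bigID (fun a : {ffun 'I_n -> 'I_N} => a i0 == b i0))/=.
  set u := (X in P _ (X + _)); set w := (X in P _ (_ + X)) => Puw.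
  have Pw : P k.+1 w.
    apply: ideal_sum => [|a /andP[aJ ab]]; first exact: idealP.
    have [_ _ PM] := idealP _ kn; apply: (PM).
    apply: idealMr; first exact: idealP.
    have : (0 < a i0 - b i0)%N.
      by rewrite subn_gt0 ltn_neqAle eq_sym ab; apply: bmin.
    case: (a i0 - b i0)%N => // m _; rewrite exprS.
    by apply: idealMr; first exact: idealP.
  have := idealB (idealP _ kn) Puw Pw; rewrite addrK /u.
  set s := (X in P _ X -> _); set s' := (X in _ -> P _ X).
  suff -> : s = s' by [].
  apply: eq_big => [a|a /andP[_ /eqP ->]]; first by rewrite inE.
  by rewrite subnn expr0 mul1r.
have [J [/set0Pn[a aJ] Jc] [Jeq]] := term n (leqnn n).
have -> : J = finset.set1 a.
  apply/setP => b; rewrite finset.in_set1; apply/idP/eqP => [bJ|-> //].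
  by apply/ffunP => i; apply: Jeq.
rewrite big_set1 big1 ?mulr1 => [Pc|i]; last by rewrite leqNgt ltn_ord.
have [[_ _ PM] P1 _] := Pp n (leqnn n); apply: P1.
by rewrite -(rmorph1 phi) -(mulVf (Jc _ aJ)) rmorphM; apply: PM.
Qed.

(** * Constants and monomials of a semigroup ring *)

Section SemigroupRingBasis.
Variables (K : fieldType) (d : nat) (S : semigroup d).
Local Notation A := (sgring K S).

Lemma sgring_const_subproof (c : K) : c%:MP_[d] \in supp_in S.
Proof.
apply/supp_inP => s; rewrite msuppC; case: ifP => // _.
by rewrite inE => /eqP ->; apply: sg0.
Qed.

Definition sgring_const (c : K) : A := SGRing (sgring_const_subproof c).

Fact sgring_const_zmod : zmod_morphism sgring_const.
Proof. by move=> p q; apply: val_inj; rewrite /= mpolyCB. Qed.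
Fact sgring_const_monoid : monoid_morphism sgring_const.
Proof. by split=> [|p q]; apply: val_inj; rewrite /= ?mpolyCM. Qed.
HB.instance Definition _ := GRing.isZmodMorphism.Build K A sgring_const
  sgring_const_zmod.
HB.instance Definition _ := GRing.isMonoidMorphism.Build K A sgring_const
  sgring_const_monoid.

(* [sgring_mon s] is the junk value [0] if [s] is not in [S]. *)
Definition sgring_mon (s : 'X_{1..d}) : A := insubd 0 'X_[s].

Lemma val_mon s : sg_set S s -> val (sgring_mon s) = 'X_[s].
Proof.
move=> Ss; rewrite /sgring_mon insubdK//; apply/supp_inP => t.
by rewrite msuppX inE => /eqP ->.
Qed.

Lemma mon0 : sgring_mon 0%MM = 1.
Proof. by apply: val_inj; rewrite val_mon ?mpolyX0//; apply: sg0. Qed.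

Lemma monD s t : sg_set S s -> sg_set S t ->
  sgring_mon (s + t)%MM = sgring_mon s * sgring_mon t.
Proof.
move=> Ss St; apply: val_inj.
by rewrite val_mon ?rmorphM/= ?mpolyXD ?val_mon//; apply: sgD.
Qed.

Lemma sg_mulmn s k : sg_set S s -> sg_set S (s *+ k)%MM.
Proof.
move=> Ss; elim: k => [|k IHk]; first by rewrite mulm0n; apply: sg0.
by rewrite mulmS; apply: sgD.
Qed.

Lemma sg_sum (I : Type) (r : seq I) (Q : pred I) (F : I -> 'X_{1..d}) :
  (forall i, Q i -> sg_set S (F i)) -> sg_set S (\sum_(i <- r | Q i) F i)%MM.
Proof.
move=> SF; elim/big_ind: _ => //; [exact: sg0|exact: sgD].
Qed.

Lemma monMn s k : sg_set S s -> sgring_mon (s *+ k)%MM = sgring_mon s ^+ k.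
Proof.
move=> Ss; elim: k => [|k IHk]; first by rewrite mulm0n mon0.
by rewrite mulmS monD ?IHk ?exprS//; apply: sg_mulmn.
Qed.

Lemma mon_sum (I : Type) (r : seq I) (Q : pred I) (F : I -> 'X_{1..d}) :
    (forall i, Q i -> sg_set S (F i)) ->
  sgring_mon (\sum_(i <- r | Q i) F i)%MM =
  \prod_(i <- r | Q i) sgring_mon (F i).
Proof.
move=> SF; elim: r => [|i r IHr]; first by rewrite !big_nil mon0.
rewrite !big_cons; case: ifP => // Qi; rewrite monD ?IHr//; first exact: SF.
exact: sg_sum.
Qed.

Lemma msupp_sgring (y : A) s : s \in msupp (val y) -> sg_set S s.
Proof. by move/(supp_inP _ _ (valP y)). Qed.

Lemma sgring_expand (y : A) :
  y = \sum_(s <- msupp (val y)) sgring_const (val y)@_s * sgring_mon s.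
Proof.
apply: val_inj; rewrite {1}[val y]mpolyE rmorph_sum; apply: eq_big_seq => s sy.
by rewrite rmorphM /= (val_mon (msupp_sgring sy)) mul_mpolyC.
Qed.

End SemigroupRingBasis.

Section DegreeBound.
Variables (K : fieldType) (d : nat).
Implicit Types p q : {mpoly K[d]}.

Let bounded k p := forall m, m \in msupp p -> (mdeg m <= k)%N.

Lemma mdeg_prod_exp n (x : 'I_n -> {mpoly K[d]}) (a : 'I_n -> nat) D :
  (forall i, bounded D (x i)) ->
  bounded (\sum_i a i * D)%N (\prod_i x i ^+ a i).
Proof.
have bM k l p q : bounded k p -> bounded l q -> bounded (k + l)%N (p * q).
  move=> bp bq m /msuppM_le/allpairsP[[u v] /= [up vq ->]].
  by rewrite mdegD leq_add ?bp ?bq.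
have b1 : bounded 0 1 by move=> m; rewrite msupp1 inE => /eqP ->; rewrite mdeg0.
move=> bx; elim/big_rec2: _ => // i p k _ bp; apply: (bM) => //.
elim: (a i) => [|l IHl]; first by rewrite expr0.
by rewrite exprS mulSn; apply: bM.
Qed.

End DegreeBound.

Section Dimension.
Variables (K : fieldType) (d : nat) (S : semigroup d).
Local Notation A := (sgring K S).

(** The right side counts products of [e.+1] elements with exponents below [N], the left side the
    exponents of [e] variables in a box containing those of bounded degree. The left side grows in
    [N] with degree [e] only. *)
Lemma box_counting e D : exists N, ((e.+1 * N * D).+1 ^ e < N ^ e.+1)%N.
Proof.
have scale N : (0 < N)%N -> ((e.+1 * N * D).+1 <= N * (e.+1 * D).+1)%N.
  by move=> N0; have -> : (e.+1 * N * D = N * (e.+1 * D))%N; lia.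
have mono m k : (m <= k)%N -> (m ^ e <= k ^ e)%N.
  by case: (e) => // e'; rewrite leq_exp2r.
(* With [C := (e.+1 * D).+1] the left side is at most [N ^ e * C ^ e], so any [N] above [C ^ e]
   works. *)
exists ((e.+1 * D).+1 ^ e).+1.
apply: leq_ltn_trans (mono _ _ (scale _ _)) _ => //.
by rewrite expnMn expnSr ltn_pmul2l ?expn_gt0.
Qed.

(** Modulo [P 0] only the variables in [E] survive. A longer chain would give [#|E|.+1] elements as
    in [prime_chain_independent], while by [box_counting] the products of their powers outnumber the
    monomials available, which yields a relation. *)
Lemma prime_chain_dim (E : {set 'I_d}) (P : nat -> set A) l :
    prime_chain P l ->
    (forall s i, sg_set S s -> i \notin E -> s i != 0%N ->
      P 0%N (sgring_mon K S s)) ->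
  (l <= #|E|)%N.
Proof.
move=> [Pp Plt] PE; rewrite leqNgt; apply/negP => ltEl.
have chainP : prime_chain P #|E|.+1.
  split=> i lei; first by apply: Pp; apply: leq_trans lei ltEl.
  by apply: Plt; apply: leq_trans lei ltEl.
have /choice[x xP] : forall i : 'I_#|E|.+1, exists x, P i.+1 x /\ ~ P i x.
  move=> i; have [_ /nonsubset[x [? ?]]] := chainP.2 i (ltn_ord i).
  by exists x.
pose D := (\max_i msize (val (x i)))%N.
have xD i m : m \in msupp (val (x i)) -> (mdeg m <= D)%N.
  move=> /msize_mdeg_lt/ltnW lem; apply: leq_trans lem _.
  by rewrite /D (bigD1 i)//= leq_maxl.
have [N ltN] := box_counting #|E| D; pose L := (#|E|.+1 * N * D)%N.
pose boxm (f : {ffun {i | i \in E} -> 'I_L.+1}) : 'X_{1..d} :=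
  [multinom if insub i is Some u then f u : nat else 0%N | i < d].
pose y (a : {ffun 'I_#|E|.+1 -> 'I_N}) := \prod_i x i ^+ a i.
have yL a m : m \in msupp (val (y a)) -> (mdeg m <= L)%N.
  have -> : val (y a) = \prod_i val (x i) ^+ a i.
    by rewrite rmorph_prod; apply: eq_bigr => i _; rewrite rmorphXn.
  move=> /(mdeg_prod_exp xD)/leq_trans; apply.
  rewrite -big_distrl/= leq_mul// -[X in (_ <= X * _)%N]card_ord -sum_nat_const.
  by apply: leq_sum => i _; apply: ltnW.
have [|c [a0 ca0] cy] :=
    @linear_dependence K _ _ (fun a f => (val (y a))@_(boxm f)).
  by rewrite !card_ffun !card_ord card_sig.
have /(prime_chain_independent chainP xP)/(_ a0)/eqP :
    P 0%N (\sum_a sgring_const S (c a) * y a); last by rewrite (negbTE ca0).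
have idP0 : is_ideal (P 0%N) by case: (Pp 0%N isT).
rewrite [X in P _ X]sgring_expand big_seq; apply: ideal_sum => // m mz.
have Sm := msupp_sgring mz; have [_ _ PM] := idP0; apply: PM.
(* A monomial of the combination that involves a variable outside [E] lies in [P 0]. Any other has
   coefficient zero, by the degree bound outside the box and by [cy] inside it. *)
have [[i [iE mi]]|mE] := pselect (exists i, i \notin E /\ m i != 0%N).
  exact: PE iE mi.
have zE : (val (\sum_a sgring_const S (c a) * y a))@_m =
    \sum_a c a * (val (y a))@_m.
  rewrite rmorph_sum raddf_sum; apply: eq_bigr => a _.
  by rewrite rmorphM /= mcoeffCM.
exfalso; move: mz; rewrite mcoeff_msupp zE; apply/negP/negPn/eqP.
have [mL|Lm] := leqP (mdeg m) L; last first.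
  rewrite big1// => a _; rewrite memN_msupp_eq0 ?mulr0//.
  by apply: contraL Lm => /yL; rewrite leqNgt.
rewrite -[RHS](cy [ffun u => inord (m (val u))]); apply: eq_bigr => a _.
congr (_ * _@__); apply/mnmP => i; rewrite mnmE.
case: insubP => [u _ <-|iE]; last first.
  by apply/eqP/negPn/negP => mi; apply: mE; exists i.
rewrite ffunE inordK// ltnS (leq_trans _ mL)// mdegE (bigD1 (val u))//=.
exact: leq_addr.
Qed.

End Dimension.

(** * The saturation of a simplicial semigroup *)

Lemma finite_representatives (X : eqType) (T : finType) (f : X -> T)
    (Q : set X) :
  exists2 l : seq X, {in l, forall x, Q x} &
    forall x, Q x -> exists2 y, y \in l & f y = f x.
Proof.
pose s := [seq t <- enum T | `[< exists2 x, Q x & f x = t >]].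
have [|l lQ sE] := @seq_preimage T X f Q s.
  by move=> t; rewrite mem_filter => /andP[/asboolP].
exists l => // x Qx; have : f x \in s.
  by rewrite mem_filter mem_enum andbT; apply/asboolP; exists x.
by rewrite sE => /mapP[y yl ->]; exists y.
Qed.

Section Saturation.
Variables (d : nat) (S : semigroup d) (omega : 'I_d -> nat).
Hypothesis omega_gt0 : forall i, (0 < omega i)%N.
Hypothesis axisS : forall i, sg_set S (axis omega i).
Hypothesis d_gt0 : (0 < d)%N.
Implicit Types s t x y : 'X_{1..d}.

Lemma axisE i k : axis omega i k = if i == k then omega k else 0%N.
Proof.
by rewrite /axis mulmnE mnm1E; case: eqP => [->|]; rewrite ?mul1n ?mul0n.
Qed.

Lemma sum_axisE (c : 'I_d -> nat) k :
  (\sum_(j < d) axis omega j *+ c j)%MM k = (omega k * c k)%N.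
Proof.
rewrite mnm_sumE (bigD1 k)//= mulmnE axisE eqxx big1 ?addn0// => j jk.
by rewrite mulmnE axisE (negbTE jk).
Qed.

Definition congruent s t := forall k, s k = t k %[mod omega k].

Lemma congruent_sym s t : congruent s t -> congruent t s.
Proof. by move=> st k; rewrite st. Qed.

Lemma congruent_trans s t x : congruent s t -> congruent t x -> congruent s x.
Proof. by move=> st tx k; rewrite st. Qed.

Lemma congruentD s t x y :
  congruent s t -> congruent x y -> congruent (s + x)%MM (t + y)%MM.
Proof. by move=> st xy k; rewrite !mnmDE -modnDm st xy modnDm. Qed.

Lemma congruent_addr s (c : 'I_d -> nat) :
  congruent (s + \sum_(j < d) axis omega j *+ c j)%MM s.
Proof. by move=> k; rewrite mnmDE sum_axisE addnC mulnC modnMDl. Qed.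

Lemma congruent_axis s k n : congruent (s + axis omega k *+ n)%MM s.
Proof.
move=> j; rewrite mnmDE mulmnE axisE addnC.
by case: eqP => _; rewrite ?mul0n// mulnC modnMDl.
Qed.

Lemma congruent_leP s t : congruent s t -> (forall k, (s k <= t k)%N) ->
  t = (s + \sum_(j < d) axis omega j *+ ((t j - s j) %/ omega j))%MM.
Proof.
move=> st le_st; apply/mnmP => k; rewrite mnmDE sum_axisE mulnC divnK.
  by rewrite subnKC.
by rewrite -eqn_mod_dvd// st.
Qed.

Lemma simP s t : sim omega s t <-> congruent s t.
Proof.
have entry (c : 'I_d -> int) k :
    (\sum_(j < d) (@zvec d \o axis omega) j *~ c j) 0 k = (omega k)%:Z * c k.
  rewrite summxE (bigD1 k)//= -scaler_int !mxE axisE eqxx big1 ?addr0.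
    by rewrite mulrC intz.
  by move=> j jk; rewrite -scaler_int !mxE axisE (negbTE jk) mulr0.
split=> [[c /rowP E] k|st].
  have := E k; rewrite entry !mxE => Ek; apply/eqP.
  have : (s k == t k %[mod omega k])%Z by rewrite eqz_mod_dvd Ek dvdz_mulr.
  by rewrite !modz_nat.
exists (fun k => ((s k)%:Z - (t k)%:Z) %/ (omega k)%:Z)%Z.
apply/rowP => k; rewrite entry !mxE mulrC divzK//.
by rewrite -eqz_mod_dvd !modz_nat st.
Qed.

Lemma sg_congruent_le s t :
  sg_set S s -> congruent s t -> (forall k, (s k <= t k)%N) -> sg_set S t.
Proof.
move=> Ss st /(congruent_leP st) ->; apply: sgD => //.
by apply: sg_sum => i _; apply: sg_mulmn.
Qed.

Lemma S0P s : S0 S omega s <->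
  sg_set S s /\ forall i t, sg_set S t -> s <> (t + axis omega i)%MM.
Proof.
rewrite /S0 /=; split=> -[Ss H]; split=> // i.
  move=> t St sE; apply: (H i); exists t => //; apply/rowP => k.
  by rewrite sE !mxE mnmDE PoszD addrK.
case=> t St /rowP E; apply: (H i t St); apply/mnmP => k; rewrite mnmDE.
by have := E k; rewrite !mxE; lia.
Qed.

(** Axis vectors are subtracted as long as the result stays in [S]; the degree drops each time.
    Hence coordinate minima over a class of [S0] agree with those over all congruent elements of
    [S]. *)
Lemma S0_below s : sg_set S s ->
  exists t, [/\ S0 S omega t, congruent t s & forall k, (t k <= s k)%N].
Proof.
have := leqnn (mdeg s); move: {2}(mdeg s) => n; elim: n s => [|n IHn] s sn Ss.
  exists s; split=> //; apply/S0P; split=> // i t St sE.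
  have := congr1 (fun u : 'X_{1..d} => u i) sE; rewrite mnmDE axisE eqxx.
  move: sn; rewrite leqn0 mdeg_eq0 => /eqP ->; rewrite mnm0E.
  by have := omega_gt0 i; lia.
have [[i [t [St sE]]]|noS] :=
    pselect (exists i t, sg_set S t /\ s = (t + axis omega i)%MM).
  have le_ts k : (t k <= s k)%N by rewrite sE mnmDE leq_addr.
  have [|//|t0 [S0t0 t0t le_t0]] := IHn t.
    rewrite -ltnS (leq_trans _ sn)// sE mdegD -addn1 leq_add2l mdegE.
    by rewrite (bigD1 i)//= axisE eqxx ltn_addr.
  exists t0; split=> // [|k]; last exact: leq_trans (le_t0 k) (le_ts k).
  apply: congruent_trans t0t _; rewrite sE -[axis omega i]mulm1n.
  exact/congruent_sym/congruent_axis.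
exists s; split=> //; apply/S0P; split=> // i t St sE.
by apply: noS; exists i, t.
Qed.

Lemma nat_min (Q : nat -> Prop) : (exists m, Q m) ->
  exists m, Q m /\ forall l, Q l -> (m <= l)%N.
Proof.
move=> exQ; have exQ' : exists m, `[< Q m >].
  by have [m Qm] := exQ; exists m; apply/asboolP.
case: (ex_minnP exQ') => m /asboolP Qm mmin; exists m; split=> // l Ql.
by apply: mmin; apply/asboolP.
Qed.

(* The least [k]-th coordinate among the elements of [S] congruent to [x];
   the junk value is [0] if there are none. *)
Definition min_coord k x : nat := xget 0%N
  [set m | (exists s, [/\ sg_set S s, congruent s x & s k = m]) /\
           forall s, sg_set S s -> congruent s x -> (m <= s k)%N].

Lemma min_coordP k x s0 : sg_set S s0 -> congruent s0 x ->
  (exists s, [/\ sg_set S s, congruent s x & s k = min_coord k x]) /\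
  forall s, sg_set S s -> congruent s x -> (min_coord k x <= s k)%N.
Proof.
move=> Ss0 s0x; rewrite /min_coord; case: xgetP => [m _ //|].
have [|m [Qm mmin]] := @nat_min
    (fun m => exists s, [/\ sg_set S s, congruent s x & s k = m]).
  by exists (s0 k), s0.
move=> /(_ m) []; split=> // s Ss sx; apply: mmin; by exists s.
Qed.

Lemma min_coord_congruent k x y :
  congruent x y -> min_coord k x = min_coord k y.
Proof.
move=> xy; rewrite /min_coord.
have E s : congruent s x = congruent s y.
  apply/propext; split=> [sx|sy]; first exact: congruent_trans sx xy.
  exact: congruent_trans sy (congruent_sym xy).
by congr (xget _ _); apply/funext => m /=; under eq_exists do rewrite E;
   under eq_forall do rewrite E.
Qed.

Definition saturated x :=
  forall k, exists s, [/\ sg_set S s, congruent s x & (s k <= x k)%N].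

Lemma saturatedP x : saturated x <->
  (exists2 s, sg_set S s & congruent s x) /\ forall k, (min_coord k x <= x k)%N.
Proof.
split=> [satx|[[s Ss sx] minx] k].
  (* An element congruent to [x] is obtained from some coordinate, which exists because [d] is
     positive. *)
  split; first by have [s []] := satx (Ordinal d_gt0); exists s.
  move=> k; have [s [Ss sx sk]] := satx k; apply: leq_trans sk.
  by have [_] := min_coordP k Ss sx; apply.
have [[t [St tx tk]] _] := min_coordP k Ss sx.
by exists t; rewrite tk.
Qed.

(** Each coordinate of a minimum vector is attained in its class, which gives saturation. Conversely
    the vector of the [min_coord k x] is the minimum vector of a class by [S0_below], and [x]
    exceeds it by multiples of the axes. *)
Lemma sprimeP x : sprime S omega x <-> saturated x.
Proof.
split.
  move=> [b [u [[C [s0 S0s0 CE] Cb] [c uE] xE]]] k.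
  have [[s Cs bk] _] := Cb k.
  have Cs' s' : C s' -> sg_set S s' /\ congruent s' s0.
    by rewrite CE => -[[]] ? _ /simP.
  have bs0 : congruent b s0.
    by move=> j; have [[s' /Cs'[_ +] ->] _] := Cb j; apply.
  have [Ss ss0] := Cs' _ Cs.
  exists s; split=> //; last by rewrite xE mnmDE bk leq_addr.
  apply: congruent_trans ss0 _; apply: congruent_sym.
  by apply: congruent_trans bs0; rewrite xE uE; apply: congruent_addr.
move=> /saturatedP[[s Ss sx] minx].
have [s0 [S0s0 s0s _]] := S0_below Ss.
have s0x : congruent s0 x by apply: congruent_trans sx.
have Ss0 : sg_set S s0 by case: S0s0.
pose b : 'X_{1..d} := [multinom min_coord k x | k < d].
have bx : congruent b x.
  by move=> k; rewrite mnmE; have [[t [_ tx <-]] _] := min_coordP k Ss0 s0x.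
exists b, (\sum_(j < d) axis omega j *+ ((x j - b j) %/ omega j))%MM; split.
- exists [set s | S0 S omega s /\ sim omega s s0]; first by exists s0.
  move=> k; rewrite mnmE; have [[t [St tx <-]] mint] := min_coordP k Ss0 s0x.
  have [t0 [S0t0 t0t le_t0]] := S0_below St.
  have t0x : congruent t0 x by apply: congruent_trans tx.
  split.
    exists t0; first split=> //.
      by apply/simP; apply: congruent_trans t0x _; apply: congruent_sym.
    apply/eqP; rewrite eqn_leq le_t0 andbT.
    by apply: mint => //; case: S0t0.
  move=> s' [S0s' /simP s's0]; apply: mint; first by case: S0s'.
  exact: congruent_trans s's0 _.
- by exists (fun j => (x j - b j) %/ omega j)%N.
- by apply: congruent_leP => // k; rewrite mnmE.
Qed.

End Saturation.

(** * Regular sequences in the ring of the saturation *)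

(** Applying [q i] to a relation expressing [g i * y] through the earlier [g j] isolates [y] on one
    side and keeps the factors [g j] on the other. *)
Lemma regular_by_division (R : comNzRingType) n (g : 'I_n -> R)
    (q : 'I_n -> {additive R -> R}) (s := [seq g k | k <- enum 'I_n]) :
    (forall k y, q k (g k * y) = y) ->
    (forall k j y, j != k -> q k (g j * y) = g j * q k y) ->
  forall i, (i < size s)%N -> forall y,
    ideal_gen (take i s) (s`_i * y) -> ideal_gen (take i s) y.
Proof.
move=> qK qM i; rewrite size_map size_enum_ord => ltin y.
have sE j (ltjn : (j < n)%N) : s`_j = g (Ordinal ltjn).
  rewrite (nth_map (Ordinal ltin)) ?size_enum_ord//.
  by rewrite (nth_ord_enum _ (Ordinal ltjn)).
rewrite sE => -[c cE]; rewrite -[y](qK (Ordinal ltin)) cE raddf_sum.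
have idI := ideal_gen_ideal (take i s).
apply: ideal_sum => // -[j /= ltj] _.
have ltji : (j < i)%N.
  by move: ltj; rewrite size_take size_map size_enum_ord ltin.
have ltjn := ltn_trans ltji ltin.
rewrite nth_take// (sE j ltjn) mulrC qM; last by rewrite -val_eqE/= ltn_eqF.
rewrite -sE; apply: idealMr => //; apply: mem_ideal_gen.
by rewrite -(nth_take _ ltji) mem_nth.
Qed.

Section MonomialExtension.
Variables (K : fieldType) (d : nat) (S : semigroup d).
Local Notation A := (sgring K S).
Variable h : 'X_{1..d} -> A.

(** The [K]-linear extension of [h] from the monomial basis. *)
Definition mon_lift (y : A) : A :=
  \sum_(s <- msupp (val y)) sgring_const S (val y)@_s * h s.

Lemma mon_liftwE (r : seq 'X_{1..d}) (y : A) : uniq r ->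
    {subset msupp (val y) <= r} ->
  mon_lift y = \sum_(s <- r) sgring_const S (val y)@_s * h s.
Proof.
move=> ur sub; rewrite (bigID (mem (msupp (val y))))/= [X in _ + X]big1 ?addr0.
  rewrite -big_filter; apply: perm_big; apply: uniq_perm.
  - exact: msupp_uniq.
  - exact: filter_uniq.
  - by move=> s; rewrite mem_filter; case: (boolP (s \in _)) => // /sub ->.
by move=> s /memN_msupp_eq0 ->; rewrite rmorph0 mul0r.
Qed.

Lemma mon_lift_zmod : zmod_morphism mon_lift.
Proof.
move=> y z; pose r := undup (msupp (val y) ++ msupp (val z)).
rewrite !(@mon_liftwE r) ?undup_uniq//; first last.
- by move=> s; rewrite mem_undup rmorphB => /msuppB_le.
- by move=> s sy; rewrite mem_undup mem_cat sy.
- by move=> s sy; rewrite mem_undup mem_cat sy orbT.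
rewrite -sumrB; apply: eq_bigr => s _.
by rewrite rmorphB /= mcoeffB rmorphB mulrBl.
Qed.
HB.instance Definition _ := GRing.isZmodMorphism.Build A A mon_lift
  mon_lift_zmod.

Lemma mon_liftZ c s : sg_set S s ->
  mon_lift (sgring_const S c * sgring_mon K S s) = sgring_const S c * h s.
Proof.
move=> Ss; have vE : val (sgring_const S c * sgring_mon K S s) = c *: 'X_[s].
  by rewrite rmorphM /= -/(val (sgring_mon K S s)) val_mon// mul_mpolyC.
rewrite (@mon_liftwE [:: s])//; last first.
  by move=> t; rewrite vE => /msuppZ_le; rewrite msuppX.
by rewrite big_seq1 vE mcoeffZ mcoeffX eqxx mulr1.
Qed.

Lemma sgring_ind (Q : A -> Prop) :
  (forall c s, sg_set S s -> Q (sgring_const S c * sgring_mon K S s)) ->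
  (forall x y, Q x -> Q y -> Q (x + y)) -> forall y, Q y.
Proof.
move=> Qm QD y; rewrite [y]sgring_expand big_seq; elim/big_ind: _ => //.
  by have := Qm 0 _ (sg0 S); rewrite rmorph0 mul0r.
by move=> s /msupp_sgring; apply: Qm.
Qed.

End MonomialExtension.

(** * The saturation as a semigroup, and division along one axis *)

Section SaturationRing.
Variables (K : fieldType) (d : nat) (S : semigroup d) (omega : 'I_d -> nat).
Hypothesis omega_gt0 : forall i, (0 < omega i)%N.
Hypothesis axisS : forall i, sg_set S (axis omega i).
Hypothesis d_gt0 : (0 < d)%N.
Implicit Types s t x y : 'X_{1..d}.

Lemma saturated0 : saturated S omega 0%MM.
Proof. by move=> k; exists 0%MM; split=> //; apply: sg0. Qed.

Lemma saturatedD x y : saturated S omega x -> saturated S omega y ->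
  saturated S omega (x + y)%MM.
Proof.
move=> satx saty k; have [s [Ss sx sk]] := satx k.
have [t [St ty tk]] := saty k; exists (s + t)%MM; split; first exact: sgD.
  exact: congruentD.
by rewrite !mnmDE leq_add.
Qed.

Definition saturation : semigroup d :=
  @Defs.Semigroup d (saturated S omega) saturated0 saturatedD.

Lemma sg_saturated s : sg_set S s -> saturated S omega s.
Proof. by move=> Ss k; exists s. Qed.

Local Notation S' := saturation.
Local Notation B := (sgring K S').
Local Notation mon := (sgring_mon K S').
Local Notation cst := (@sgring_const K d S').
Local Notation axis := (axis omega).

Lemma sat_axis i : sg_set S' (axis i).
Proof. exact: sg_saturated. Qed.

(** For saturated [x], this is how often [axis k] can be subtracted within the saturation. The
    remainder [foot k x] has the minimal [k]-th coordinate of its class. *)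
Definition level k x : nat := ((x k - min_coord S omega k x) %/ omega k)%N.
Definition foot k x : 'X_{1..d} := (x - axis k *+ level k x)%MM.

Lemma footE k x j :
  foot k x j = if k == j then (x k - omega k * level k x)%N else x j.
Proof.
rewrite /foot mnmBE mulmnE axisE; case: eqP => [->//|_].
by rewrite mul0n subn0.
Qed.

Lemma omega_level_le k x : saturated S omega x ->
  (omega k * level k x <= x k - min_coord S omega k x)%N.
Proof. by rewrite mulnC leq_trunc_div. Qed.

Lemma footK k x : saturated S omega x ->
  (foot k x + axis k *+ level k x)%MM = x.
Proof.
move=> satx; rewrite submK//; apply/mnm_lepP => j; rewrite mulmnE axisE.
case: eqP => [<-|]; last by rewrite mul0n.
exact: leq_trans (omega_level_le k satx) (leq_subr _ _).
Qed.

Lemma foot_congruent k x : saturated S omega x -> congruent omega (foot k x) x.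
Proof.
by move=> satx; rewrite -[x in congruent _ _ x](footK k satx);
   apply/congruent_sym/congruent_axis.
Qed.

Lemma foot_saturated k x : saturated S omega x -> sg_set S' (foot k x).
Proof.
move=> satx; apply/(saturatedP S omega d_gt0).
have [[s Ss sx] minx] := (saturatedP S omega d_gt0 x).1 satx.
have fx := foot_congruent k satx; split.
  by exists s => //; apply: congruent_trans sx (congruent_sym fx).
move=> j; rewrite (min_coord_congruent _ _ fx) footE.
case: eqP => [<-|_]; last exact: minx.
by have := omega_level_le k satx; have := minx k; lia.
Qed.

Lemma level_axis k x : saturated S omega x ->
  level k (x + axis k)%MM = (level k x).+1.
Proof.
move=> satx; have [_ minx] := (saturatedP S omega d_gt0 x).1 satx.
rewrite /level (min_coord_congruent _ _ (y := x)); last first.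
  by have := congruent_axis omega x k 1; rewrite mulm1n.
rewrite mnmDE axisE eqxx addnC -addnBA// -{1}[omega k]mul1n divnMDl//.
Qed.

Lemma level_axis_neq k j x : j != k -> level k (x + axis j)%MM = level k x.
Proof.
move=> jk; rewrite /level (min_coord_congruent _ _ (y := x)); last first.
  by have := congruent_axis omega x j 1; rewrite mulm1n.
by rewrite mnmDE axisE (negbTE jk) addn0.
Qed.

Lemma foot_axis k x : saturated S omega x -> foot k (x + axis k)%MM = foot k x.
Proof.
move=> satx; rewrite /foot level_axis// mulmSr addmC.
by apply/mnmP => j; rewrite !mnmBE !mnmDE mulmnE axisE; lia.
Qed.

Lemma foot_axis_neq k j x : j != k ->
  foot k (x + axis j)%MM = (foot k x + axis j)%MM.
Proof.
move=> jk; apply/mnmP => l.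
rewrite mnmDE !footE level_axis_neq// !mnmDE !axisE.
by case: (eqVneq k l) => [<-|//]; rewrite (negbTE jk) !addn0.
Qed.

Lemma saturated_axis x k : saturated S omega x ->
  saturated S omega (x + axis k)%MM.
Proof. by move=> satx; apply: saturatedD => //; apply: sat_axis. Qed.

Definition axis_poly k (f : {poly K}) : B := eval_at cst (mon (axis k)) f.

Section Division.
Variables (k : 'I_d) (f : {poly K}).
Hypothesis f0 : f != 0.

(* Division by [f], as a polynomial in [t ^ axis k], of the elements of [B]
   written on the basis of the [mon s] with [level k s = 0]. *)
Definition quo : B -> B :=
  mon_lift (fun s => axis_poly k ('X^(level k s) %/ f) * mon (foot k s)).
HB.instance Definition _ := GRing.Additive.on quo.

Lemma quo_mon c s : sg_set S' s -> quo (cst c * mon s) =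
  cst c * (axis_poly k ('X^(level k s) %/ f) * mon (foot k s)).
Proof. exact: mon_liftZ. Qed.

(** Multiplication by the monomial of [axis k] raises the level by one and fixes the foot; the
    induction on [p] therefore varies [s]. *)
Lemma quo_axis_poly p c s : sg_set S' s ->
  quo (axis_poly k p * (cst c * mon s)) =
  cst c * (axis_poly k ((p * 'X^(level k s)) %/ f) * mon (foot k s)).
Proof.
elim/poly_ind: p s => [|p b IHp] s Ss.
  by rewrite mul0r div0p /axis_poly rmorph0 !mul0r mulr0 raddf0.
rewrite /axis_poly rmorphD rmorphM/= eval_atX eval_atC -/(axis_poly k p).
rewrite mulrDl raddfD/=.
have -> : axis_poly k p * mon (axis k) * (cst c * mon s) =
    axis_poly k p * (cst c * mon (s + axis k)%MM).
  by rewrite monD//; [ring|apply: sat_axis].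
rewrite IHp; last exact: saturated_axis.
rewrite [cst b * _]mulrA -rmorphM quo_mon// level_axis// foot_axis//.
rewrite mulrDl divpD -mulrA -exprS.
rewrite mul_polyC divpZl -mul_polyC /axis_poly rmorphD (rmorphM _ b%:P)/=.
by rewrite eval_atC rmorphM; ring.
Qed.

Lemma quoK (y : B) : quo (axis_poly k f * y) = y.
Proof.
elim/sgring_ind: y => [c s Ss|x y xE yE].
  have Sa : sg_set S' (axis k *+ level k s)%MM.
    by apply: sg_mulmn; apply: sat_axis.
  have Sf := foot_saturated k Ss.
  have sE : mon s = mon (foot k s) * mon (axis k *+ level k s)%MM.
    by rewrite -(monD K Sf Sa) footK.
  rewrite quo_axis_poly// mulKp// /axis_poly rmorphXn/= eval_atX sE.
  by rewrite (monMn K _ (sat_axis k)) [X in _ * X]mulrC.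
by rewrite mulrDr raddfD/= xE yE.
Qed.

(** Adding [axis j] preserves the level along [k] and shifts the foot by [axis j], so [quo] commutes
    with that monomial and hence with polynomials in it. *)
Lemma quoM j (g : {poly K}) (y : B) : j != k ->
  quo (axis_poly j g * y) = axis_poly j g * quo y.
Proof.
move=> jk; elim/poly_ind: g y => [|g b IHg] y.
  by rewrite /axis_poly rmorph0 !mul0r raddf0.
have quoC c z : quo (cst c * z) = cst c * quo z.
  elim/sgring_ind: z => [e s Ss|x z xE zE].
    by rewrite mulrA -rmorphM !quo_mon// rmorphM -!mulrA.
  by rewrite mulrDr !raddfD/= xE zE mulrDr.
have quoX z : quo (mon (axis j) * z) = mon (axis j) * quo z.
  elim/sgring_ind: z => [e s Ss|x z xE zE].
    have -> : mon (axis j) * (cst e * mon s) = cst e * mon (s + axis j)%MM.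
      by rewrite monD//; [ring|apply: sat_axis].
    rewrite !quo_mon//; last exact: saturated_axis.
    rewrite level_axis_neq// foot_axis_neq// monD; first by ring.
      exact: foot_saturated.
    exact: sat_axis.
  by rewrite mulrDr !raddfD/= xE zE mulrDr.
rewrite /axis_poly rmorphD rmorphM/= eval_atX eval_atC -/(axis_poly j g).
rewrite mulrDl raddfD/=.
by rewrite -mulrA IHg quoX quoC mulrDl mulrA.
Qed.

End Division.
End SaturationRing.

(** * The Macaulayfication *)

Section CohenMacaulay.
Variables (K : fieldType) (d : nat) (S : semigroup d) (omega : 'I_d -> nat).
Hypothesis omega_gt0 : forall i, (0 < omega i)%N.
Hypothesis axisS : forall i, sg_set S (axis omega i).
Hypothesis d_gt0 : (0 < d)%N.
Local Notation S' := (saturation S omega).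
Local Notation B := (sgring K S').
Local Notation mon := (sgring_mon K S').
Local Notation cst := (@sgring_const K d S').

Lemma congruent_representatives : exists2 l : seq 'X_{1..d},
  {in l, forall s, saturated S omega s} &
  forall s, saturated S omega s -> exists2 t, t \in l & congruent omega t s.
Proof.
pose W := (\max_i omega i)%N.
pose res (s : 'X_{1..d}) := [ffun k => inord (s k %% omega k) : 'I_W.+1].
have resE s k : res s k = (s k %% omega k)%N :> nat.
  rewrite ffunE inordK// ltnS (leq_trans (ltnW _) (leq_bigmax k))//.
  by rewrite ltn_mod.
have [l lsat lrep] := finite_representatives res (saturated S omega).
exists l => // s /lrep[t tl E]; exists t => // k.
by rewrite -!resE E.
Qed.

(** The generators are the axis monomials and, for each of the finitely many congruence classes, the
    monomial of its vector of minimal coordinates. *)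
Lemma saturation_generated : exists ys : seq B, generates cst ys.
Proof.
have [l lsat lrep] := congruent_representatives.
pose low (s : 'X_{1..d}) : 'X_{1..d} :=
  [multinom min_coord S omega k s | k < d].
exists ([seq mon (axis omega k) | k <- enum 'I_d] ++
  [seq mon (low s) | s <- l]).
move=> Z Zcst Zys ZD ZM z; elim/sgring_ind: z => [c s Ss|x y]; last exact: ZD.
apply: (ZM) => //.
have [[s0 Ss0 s0s] mins] := (saturatedP S omega d_gt0 s).1 Ss.
have lows : congruent omega (low s) s.
  by move=> k; rewrite mnmE; have [[t [_ ts <-]] _] := min_coordP k Ss0 s0s.
have satlow : sg_set S' (low s).
  apply/(saturatedP S omega d_gt0); split.
    exists s0 => //; exact: congruent_trans s0s (congruent_sym lows).
  by move=> k; rewrite (min_coord_congruent _ _ lows) mnmE.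
have [|t tl ts] := lrep s; first by [].
have Zlow : Z (mon (low s)).
  apply: Zys; rewrite mem_cat; apply/orP; right; apply/mapP; exists t => //.
  by congr mon; apply/mnmP => k; rewrite !mnmE; apply/esym/min_coord_congruent.
rewrite (congruent_leP lows) => [|k]; last by rewrite mnmE.
rewrite monD//; last by apply: sg_sum => i _; apply/sg_mulmn/sat_axis.
apply: (ZM) => //; rewrite mon_sum => [|i _]; last exact/sg_mulmn/sat_axis.
have Z1 : Z 1 by rewrite -(rmorph1 cst); apply: Zcst.
elim/big_ind: _ => // i _; rewrite monMn; last exact: sat_axis.
elim: (_ %/ _)%N => [|k IHk]; first by rewrite expr0.
rewrite exprS; apply: (ZM) => //; apply: Zys.
by rewrite mem_cat; apply/orP; left; apply/mapP; exists i; rewrite ?mem_enum.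
Qed.

Lemma saturation_cohen_macaulay : cohen_macaulay B.
Proof.
have [ys gen] := saturation_generated.
split=> [|M maxM]; first exact: noetherian_generated gen (@noetherian_field K).
have primeM := maximal_prime maxM; have [idM M1 _] := maxM.
have dimB (P : nat -> set B) l : prime_chain P l -> (l <= d)%N.
  move=> /(@prime_chain_dim K d S' finset.setT); rewrite cardsT card_ord; apply.
  by move=> s i _; rewrite inE.
(* With [dimB] this chain bounds the length of every regular sequence in [M]; for the sequence of
   length [d] built below it also shows that the height reaches [d]. *)
have regB s : regular_seq s -> {in s, forall x, M x} ->
    exists P : nat -> set B, prime_chain P (size s) /\ P (size s) = M.
  by move=> [reg _] sM; apply: regular_prime_chain.
have /choice[f fP] : forall k : 'I_d, exists f : {poly K},
    f != 0 /\ M (axis_poly S omega k f).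
  move=> k; have [f f0 Mf] := residue_algebraic maxM (mon (axis omega k)) gen.
  by exists f.
pose s := [seq axis_poly S omega k (f k) | k <- enum 'I_d].
have sM : {in s, forall x, M x} by move=> _ /mapP[k _ ->]; case: (fP k).
have szs : size s = d by rewrite size_map size_enum_ord.
have regs : regular_seq s.
  split; last by move=> /(ideal_gen_sub idM sM).
  apply: (@regular_by_division B d (fun k => axis_poly S omega k (f k))
    (fun k => @quo K d S omega k (f k) : {additive B -> B})).
    by move=> k y; apply: quoK => //; case: (fP k).
  by move=> k j y jk; apply: quoM.
exists d; split; split.
- by exists s.
- by move=> s' rs' s'M; have [P [/dimB]] := regB _ rs' s'M.
- by have [P] := regB _ regs sM; rewrite szs; exists P.
- by move=> P l /dimB.
Qed.

(** An element of [S] with minimal [k]-th coordinate can be chosen per congruence class, and there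
    are finitely many classes. *)
Lemma uniform_lower_bound k : exists N, forall s, saturated S omega s ->
  exists x, [/\ sg_set S x, congruent omega x s, (x k <= s k)%N &
                forall j, (x j <= N)%N].
Proof.
have [l lsat lrep] := congruent_representatives.
have /choice[g gP] : forall t, exists x, saturated S omega t ->
    [/\ sg_set S x, congruent omega x t & x k = min_coord S omega k t].
  move=> t; have [satt|nsatt] := pselect (saturated S omega t).
    have [[s0 Ss0 s0t] _] := (saturatedP S omega d_gt0 t).1 satt.
    by have [[x xP] _] := min_coordP k Ss0 s0t; exists x.
  by exists 0%MM.
exists (\max_(t <- l) mdeg (g t))%N => s sats.
have [t tl ts] := lrep s sats; have [Sx xt xk] := gP t (lsat t tl).
exists (g t); split=> //; first exact: congruent_trans ts.
  rewrite xk (min_coord_congruent _ _ ts).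
  by have [_] := (saturatedP S omega d_gt0 s).1 sats; apply.
move=> j; apply: (@leq_trans (mdeg (g t))).
  by rewrite mdegE (bigD1 j)//= leq_addr.
exact: leq_bigmax_seq.
Qed.

(** The multiple [s *+ W] is a sum of axis vectors that uses [axis omega i] at least once, so a
    power of the monomial of [s] lies in [P]. *)
Lemma prime_mon_axis (P : set (sgring K S)) i s : is_prime_ideal P ->
    P (sgring_mon K S (axis omega i)) -> sg_set S s -> s i != 0%N ->
  P (sgring_mon K S s).
Proof.
move=> Pp Pi Ss si; pose W := (\prod_j omega j)%N.
have W_gt0 : (0 < W)%N by apply: prodn_gt0.
have dvdW j : (omega j %| W)%N by rewrite /W (bigD1 j)//= dvdn_mulr.
(* The term [j == i] sets aside one copy of [axis omega i]. *)
pose t := (\sum_j axis omega j *+ (s j * (W %/ omega j) - (j == i)))%MM.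
have St : sg_set S t by apply: sg_sum => j _; apply: sg_mulmn.
have sWE : (s *+ W = axis omega i + t)%MM.
  apply/mnmP => j; rewrite mulmnE mnmDE axisE sum_axisE mulnBr.
  rewrite mulnCA (mulnC (omega j) (W %/ omega j)%N) divnK//.
  case: eqP => [<-|/eqP/negbTE ij]; last by rewrite eq_sym ij muln0 subn0.
  rewrite eqxx muln1 subnKC// (leq_trans (dvdn_leq W_gt0 (dvdW i)))//.
  by rewrite leq_pmull// lt0n.
apply: (prime_exp Pp (n := W)); rewrite -monMn// sWE monD//.
by case: Pp => idP _ _; apply: idealMr.
Qed.

Lemma saturation_coker_dim (hS : S `<=` S') :
  @module_dim_le (sgring K S) (coker (sgring_incl K hS)) (d%:Z - 2).
Proof.
move=> P l chainP annP.
have [Pp _] := chainP; have P0p := Pp 0%N isT.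
have axisP (k : 'I_d) :
    exists2 j, j != k & P 0%N (sgring_mon K S (axis omega j)).
  have [N NP] := uniform_lower_bound k.
  have SN j : sg_set S (axis omega j *+ N)%MM by apply: sg_mulmn.
  pose u := (\sum_(j < d | j != k) axis omega j *+ N)%MM.
  have uE : u = (\sum_(j < d) axis omega j *+ ((j != k) * N))%MM.
    rewrite /u big_mkcond; apply: eq_bigr => j _.
    by case: eqP => _; rewrite ?mul1n ?mul0n.
  have Su : sg_set S u by apply: sg_sum.
  have : P 0%N (sgring_mon K S u).
    apply: annP => m; rewrite -(coker_reprK m); set y := repr m.
    have supp : val (sgring_incl K hS (sgring_mon K S u) * y) \in supp_in S.
      (* Adding [u] to an exponent [b] lands above the witness [x] of [NP]: coordinate [k] is
         already large enough, and the others grow by at least [N]. *)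
      apply/supp_inP => s; rewrite rmorphM => /msuppM_le/allpairsP[[v b] /=].
      rewrite val_mon// msuppX inE => -[/eqP-> bsupp ->].
      have [x [Sx xb xk xN]] := NP b (msupp_sgring bsupp).
      apply: (sg_congruent_le axisS Sx).
        apply: congruent_trans xb _; rewrite uE addmC.
        exact/congruent_sym/congruent_addr.
      move=> j; rewrite mnmDE uE sum_axisE.
      have [->|_] := eqVneq j k; first by rewrite mul0n muln0.
      rewrite mul1n; apply: leq_trans (xN j) _.
      by apply: leq_trans (leq_addr _ _); apply: leq_pmull.
    have <- : coker_pi (sgring_incl K hS) 0 = 0 by rewrite /coker_pi raddf0.
    rewrite [_ *: _]coker_scaleE; apply/coker_piP.
    by exists (SGRing supp); apply: val_inj; rewrite subr0.
  rewrite mon_sum//; under eq_bigr do rewrite monMn//.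
  by case/prime_prod => // j jk /(prime_exp P0p); exists j.
(* The first index is arbitrary, and a second use at [j1] yields a different axis. For [d = 1] the
   existence of [j1] is already contradictory, in accordance with a zero cokernel. *)
have [j1 _ Pj1] := axisP (Ordinal d_gt0); have [j2 j21 Pj2] := axisP j1.
have : (l <= #|(~: [set j1; j2])%SET|)%N.
  apply: (prime_chain_dim chainP) => s i Ss.
  rewrite !finset.inE negbK => /orP[]/eqP ->; exact: prime_mon_axis.
have := cardsC [set j1; j2]%SET; rewrite card_ord cards2 eq_sym j21.
by lia.
Qed.
End CohenMacaulay.

Local Close Scope ring_scope.
Local Close Scope classical_set_scope.

Theorem theorem4 (K : fieldType) (hK : infinite_set [set: K]%classic)
    (d n : nat) (hd : 1 <= d) (hdn : d <= n)
    (a : 'I_n -> 'X_{1..d}) (omega : 'I_d -> nat)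
    (ha : forall j, a j <> 0%MM)
    (homega : forall i, 0 < omega i)
    (haxis : forall (i : 'I_d) (j : 'I_n),
        nat_of_ord j = n - d + i -> a j = (U_(i) *+ omega i)%MM) :
  exists S' : semigroup d,
    sg_set S' = sprime (gen_semigroup a) omega /\
    is_macaulayfication K (gen_semigroup a) S'.
Proof.
set S := gen_semigroup a.
have axisS i : sg_set S (axis omega i).
  have ltj : (n - d + i < n)%N by have := ltn_ord i; lia.
  exists (fun j => (j == Ordinal ltj) : nat).
  rewrite (bigD1 (Ordinal ltj))//= eqxx mulm1n big1 ?addm0.
    by rewrite (haxis i (Ordinal ltj)).
  by move=> j /negbTE ->; rewrite mulm0n.
exists (saturation S omega); split.
  by apply/seteqP; split=> x /(sprimeP S homega hd).
have hS : (S `<=` saturation S omega)%classic by move=> s; apply: sg_saturated.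
exists hS; split; first exact: saturation_cohen_macaulay.
exact: saturation_coker_dim.
Qed.
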